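(* Let $p$ be a prime, and suppose that MC$\mathbf{1}$ holds, i.e. for every finite group $H$ with Sylow $p$-subgroup $Q$, $(\mathbb{C}[H], \mathbb{C}[N_H(Q)])$ is an M-pair. Then for all finite groups $G$, all finite non-empty left $G$-sets $X$, and all normalized $2$-cocycles $\alpha \in Z^2(G, U(\mathbb{C}[X]^* ))$, the pair $(D_X^{\alpha}(G), D_X^{\alpha}(N))$ is an M-pair, where $N = N_G(P)$ is the normalizer in $G$ of a Sylow $p$-subgroup $P$ of $G$.
   Context: All algebras and modules are finite-dimensional over $\mathbb{C}$. The prime $p$ is fixed. For an algebra $A$, $\mu(A)$ denotes the number of inequivalent simple $A$-modules of dimension coprime to $p$. A pair of algebras $(A,B)$ is an M-pair if $\mu(A)=\mu(B)$. For a finite group $G$ and a finite non-empty left $G$-set $X$, $\mathbb{C}[X]^*$ is the algebra of complex functions on $X$ under pointwise multiplication, with basis the delta functions $e(x): y\mapsto \delta_{x,y}$; $G$ acts on it by algebra automorphisms via $g: e(x)\mapsto e(g.x)$. Let $U = U(\mathbb{C}[X]^* ) = \{\sum_x \lambda_x e(x) \mid \lambda_x \neq 0 \text{ for all } x\}$ be its group of units, a multiplicative left $G$-module. A normalized $2$-cocycle $\alpha\in Z^2(G,U)$ is written $\alpha(g,h) = \sum_{x\in X}\alpha_x(g,h)e(x)$; the cocycle property amounts to $$\alpha_x(g,h)\,\alpha_x(gh,k) = \alpha_x(g,hk)\,\alpha_{g^{-1}.x}(h,k), \quad g,h,k\in G,\ x\in X,$$ and normalized means $\alpha_x(1,g)=\alpha_x(g,1)=1$.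 $D_X^{\alpha}(G)$ is the associative algebra with underlying space $\mathbb{C}[X]^*\otimes_{\mathbb{C}}\mathbb{C}[G]$ and product $$(e(x)\otimes g)(e(y)\otimes h) = \alpha_x(g,h)\,\delta_{x,g.y}\, e(x)\otimes gh.$$ In $D_X^{\alpha}(N)$, $X$ is regarded as an $N$-set by restriction and $\alpha$ is restricted to $N\times N$. *)

(* Defs.v *)
From HB Require Import structures.
From mathcomp Require Import all_boot all_order all_algebra all_fingroup.
From mathcomp Require Import all_solvable all_field.
From mathcomp Require Import finmap boolp classical_sets cardinality.

Set Implicit Arguments.
Unset Strict Implicit.
Unset Printing Implicit Defensive.

Import GRing.Theory.
Local Open Scope ring_scope.

(* A nonzero finite-dimensional left A-module, up to isomorphism: the space   *)
(* of column vectors of length n.+1, on which a acts by v |-> rho a *m v.     *)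
(* The zero module, which is not simple, is left out.                         *)
Definition amodule (F : fieldType) (A : falgType F) : Type :=
  {n : nat & {lrmorphism A -> 'M[F]_n.+1}}.

Section Modules.
Variables (F : fieldType) (A : falgType F).
Implicit Types M : amodule A.

Definition mod_dim M : nat := (tag M).+1.

Definition mod_act M (a : A) (v : 'cV[F]_(mod_dim M)) : 'cV[F]_(mod_dim M) :=
  tagged M a *m v.

Definition submodule M (U : {vspace 'cV[F]_(mod_dim M)}) : Prop :=
  forall (a : A) v, v \in U -> mod_act a v \in U.

Definition simple_mod M : Prop :=
  forall U : {vspace 'cV[F]_(mod_dim M)},
    submodule U -> U = 0%VS \/ U = fullv.

Definition mod_iso M M' : Prop :=
  exists2 f : {linear 'cV[F]_(mod_dim M) -> 'cV[F]_(mod_dim M')},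
    bijective f & forall a v, f (mod_act a v) = mod_act a (f v).

Definition iso_class M : set (amodule A) := [set M' | mod_iso M M']%classic.

Definition simple_classes_coprime (p : nat) : set (set (amodule A)) :=
  [set iso_class M | M in
     [set M | simple_mod M /\ coprime (mod_dim M) p]]%classic.

(* fset_set is the finite set underlying a finite classical set (and is empty *)
(* on infinite ones); a finite-dimensional algebra has only finitely many     *)
(* simple modules up to isomorphism.                                          *)
Definition mu (p : nat) : nat := #|` fset_set (simple_classes_coprime p)|%fset.

End Modules.

Definition M_pair (p : nat) (F : fieldType) (A B : falgType F) : Prop :=
  mu A p = mu B p.

Definition group_algebra (F : fieldType) (G : finGroupType) : Type :=
  {ffun G -> F^o}.

Section GroupAlgebra.
Variables (F : fieldType) (G : finGroupType).
Local Notation A := (group_algebra F G).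
HB.instance Definition _ := Vector.on A.

Definition ga_basis (g : G) : A := [ffun h => (h == g)%:R].

Definition ga_mul (a b : A) : A :=
  \sum_(g : G) \sum_(h : G) (a g * b h) *: ga_basis (g * h)%g.

Definition ga_one : A := ga_basis 1%g.

Lemma ga_mulE a b k : ga_mul a b k = \sum_(g : G) a g * b (g^-1 * k)%g.
Proof.
rewrite /ga_mul sum_ffunE; apply: eq_bigr => g _; rewrite sum_ffunE.
rewrite (bigD1 (g^-1 * k)%g) //= big1 => [|h nh].
  by rewrite !ffunE mulKVg eqxx /GRing.scale /= mulr1 addr0.
rewrite !ffunE; have [kE|_] := eqVneq; last by rewrite scaler0.
by rewrite kE mulKg eqxx in nh.
Qed.

Fact ga_mulA : associative ga_mul.
Proof.
move=> a b c; apply/ffunP=> k; rewrite !ga_mulE.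
under eq_bigr do rewrite ga_mulE big_distrr /=.
under [RHS]eq_bigr do rewrite ga_mulE big_distrl /=.
rewrite [RHS]exchange_big /=; apply: eq_bigr => g _.
rewrite [RHS](reindex_inj (mulgI g)) /=; apply: eq_bigr => h _.
by rewrite mulKg invMg !mulgA mulrA.
Qed.

Fact ga_mul1 : left_id ga_one ga_mul.
Proof.
move=> a; apply/ffunP=> k; rewrite ga_mulE (bigD1 1%g) //= big1 => [|g /negPf ng].
  by rewrite !ffunE eqxx mul1r invg1 mul1g addr0.
by rewrite !ffunE ng mul0r.
Qed.

Fact ga_mulr1 : right_id ga_one ga_mul.
Proof.
move=> a; apply/ffunP=> k; rewrite ga_mulE (bigD1 k) //= big1 => [|g ng].
  by rewrite !ffunE mulVg eqxx mulr1 addr0.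
rewrite !ffunE -eq_mulVg1 in ng *; rewrite (negPf ng) ?mulr0 //.
Qed.

Fact ga_mulDl : left_distributive ga_mul +%R.
Proof.
move=> a b c; apply/ffunP=> k; rewrite [RHS]ffunE !ga_mulE -big_split /=.
by apply: eq_bigr => g _; rewrite !ffunE mulrDl.
Qed.

Fact ga_mulDr : right_distributive ga_mul +%R.
Proof.
move=> a b c; apply/ffunP=> k; rewrite [RHS]ffunE !ga_mulE -big_split /=.
by apply: eq_bigr => g _; rewrite !ffunE mulrDr.
Qed.

Fact ga_1neq0 : ga_one != 0.
Proof.
by apply/eqP=> /ffunP/(_ 1%g)/eqP; rewrite !ffunE eqxx oner_eq0.
Qed.

HB.instance Definition _ := GRing.Zmodule_isNzRing.Build A
  ga_mulA ga_mul1 ga_mulr1 ga_mulDl ga_mulDr ga_1neq0.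

Fact ga_scalerAl (c : F) (a b : A) : c *: (a * b) = (c *: a) * b.
Proof.
apply/ffunP=> k; rewrite [LHS]ffunE [RHS]ga_mulE [X in _ *: X]ga_mulE scaler_sumr.
by apply: eq_bigr => g _; rewrite !ffunE scalerAl.
Qed.

HB.instance Definition _ := GRing.Lmodule_isLalgebra.Build F A ga_scalerAl.

Fact ga_scalerAr (c : F) (a b : A) : c *: (a * b) = a * (c *: b).
Proof.
apply/ffunP=> k; rewrite [LHS]ffunE [RHS]ga_mulE [X in _ *: X]ga_mulE scaler_sumr.
by apply: eq_bigr => g _; rewrite !ffunE scalerAr.
Qed.

HB.instance Definition _ := GRing.Lalgebra_isAlgebra.Build F A ga_scalerAr.
HB.instance Definition _ := Algebra_isFalgebra.Build F A.

Lemma ga_basisM (g h : G) : ga_basis g * ga_basis h = ga_basis (g * h)%g.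
Proof.
apply/ffunP=> k; rewrite [LHS]ga_mulE (bigD1 g) //= big1 => [|u /negPf nu].
  by rewrite !ffunE eqxx mul1r addr0 -(inj_eq (mulgI g)) mulKVg.
by rewrite !ffunE nu mul0r.
Qed.

End GroupAlgebra.

Record gset (G : finGroupType) := Gset {
  gset_sort :> finType;
  gact : G -> gset_sort -> gset_sort;
  gact1 : forall x, gact 1%g x = x;
  gactM : forall g h x, gact (g * h)%g x = gact g (gact h x);
  gset_nonempty : (0 < #|gset_sort|)%N
}.

(* A normalized 2-cocycle of G in the units of the algebra of F-valued        *)
(* functions on X, in coordinates: [alpha g h x] is alpha_x(g,h).              *)
Record cocycle (F : fieldType) (G : finGroupType) (X : gset G) := Cocycle {
  cocycle_val :> G -> G -> {ffun X -> F};
  cocycle_unit : forall g h x, cocycle_val g h x != 0;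
  cocycleP : forall g h k x,
    cocycle_val g h x * cocycle_val (g * h)%g k x
    = cocycle_val g (h * k)%g x * cocycle_val h k (gact g^-1%g x);
  cocycle1g : forall g x, cocycle_val 1%g g x = 1;
  cocycleg1 : forall g x, cocycle_val g 1%g x = 1
}.

Section Restriction.
Variables (F : fieldType) (G : finGroupType) (X : gset G) (H : {group G}).

Definition res_gact (h : subg_of H) (x : X) : X := gact (sgval h) x.

Fact res_gact1 x : res_gact 1%g x = x. Proof. exact: gact1. Qed.

Fact res_gactM g h x : res_gact (g * h)%g x = res_gact g (res_gact h x).
Proof. exact: gactM. Qed.

Definition res_gset : gset (subg_of H) :=
  Gset res_gact1 res_gactM (gset_nonempty X).

Variable alpha : cocycle F X.

Definition res_cocycle_val (g h : subg_of H) : {ffun res_gset -> F} :=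
  alpha (sgval g) (sgval h).

Fact res_cocycle_unit g h x : res_cocycle_val g h x != 0.
Proof. exact: cocycle_unit. Qed.

Fact res_cocycleP g h k x :
  res_cocycle_val g h x * res_cocycle_val (g * h)%g k x
  = res_cocycle_val g (h * k)%g x * res_cocycle_val h k (gact g^-1%g x).
Proof. exact: cocycleP. Qed.

Fact res_cocycle1g g x : res_cocycle_val 1%g g x = 1.
Proof. exact: cocycle1g. Qed.

Fact res_cocycleg1 g x : res_cocycle_val g 1%g x = 1.
Proof. exact: cocycleg1. Qed.

Definition res_cocycle : cocycle F res_gset :=
  Cocycle res_cocycle_unit res_cocycleP res_cocycle1g res_cocycleg1.

End Restriction.

(* D_X^alpha(G): [a (x, g)] is the coefficient of e(x) (x) g in a.             *)
Definition twisted_double (F : fieldType) (G : finGroupType) (X : gset G)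
  (alpha : cocycle F X) : Type := {ffun X * G -> F^o}.

Section TwistedDouble.
Variables (F : fieldType) (G : finGroupType) (X : gset G).
Variable alpha : cocycle F X.
Local Notation D := (twisted_double alpha).
HB.instance Definition _ := Vector.on D.

Definition td_basis (x : X) (g : G) : D := [ffun z => (z == (x, g))%:R].

Definition td_mul (a b : D) : D :=
  \sum_(x : X) \sum_(g : G) \sum_(y : X) \sum_(h : G)
    (a (x, g) * b (y, h) * (alpha g h x * (x == gact g y)%:R))
      *: td_basis x (g * h)%g.

Definition td_one : D := \sum_(x : X) td_basis x 1%g.

Lemma gactK (g : G) : cancel (@gact G X g) (gact g^-1%g).
Proof. by move=> x; rewrite -gactM mulVg gact1. Qed.

Lemma gactKV (g : G) : cancel (@gact G X g^-1%g) (gact g).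
Proof. by move=> x; rewrite -gactM mulgV gact1. Qed.

Lemma td_mulE (a b : D) x k : td_mul a b (x, k) =
  \sum_(g : G) a (x, g) * b (gact g^-1%g x, (g^-1 * k)%g)
                        * alpha g (g^-1 * k)%g x.
Proof.
rewrite /td_mul sum_ffunE (bigD1 x) //= [X in _ + X]big1 ?addr0; last first.
  move=> y ny; rewrite sum_ffunE big1 // => g _; rewrite sum_ffunE big1 // => z _.
  rewrite sum_ffunE big1 // => h _; rewrite !ffunE xpair_eqE [x == y]eq_sym.
  by rewrite (negPf ny) scaler0.
rewrite sum_ffunE; apply: eq_bigr => g _; rewrite sum_ffunE.
rewrite (bigD1 (gact g^-1%g x)) //= [X in _ + X]big1 ?addr0; last first.
  move=> y ny; rewrite sum_ffunE big1 // => h _; rewrite [LHS]ffunE.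
  have [xE|_] := eqVneq x (gact g y); last by rewrite !mulr0 scale0r.
  by rewrite xE gactK eqxx in ny.
rewrite sum_ffunE (bigD1 (g^-1 * k)%g) //= big1 => [|h nh].
  by rewrite !ffunE mulKVg eqxx gactKV eqxx /GRing.scale /= !mulr1 addr0.
rewrite !ffunE xpair_eqE eqxx /=.
have [kE|_] := eqVneq k (g * h)%g; last by rewrite scaler0.
by rewrite kE mulKg eqxx in nh.
Qed.

Lemma td_oneE x k : td_one (x, k) = (k == 1%g)%:R.
Proof.
rewrite /td_one sum_ffunE (bigD1 x) //= big1 => [|y ny].
  by rewrite ffunE xpair_eqE eqxx addr0.
by rewrite ffunE xpair_eqE [x == y]eq_sym (negPf ny).
Qed.

Fact td_mulA : associative td_mul.
Proof.
move=> a b c; apply/ffunP=> -[x k]; rewrite !td_mulE.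
under eq_bigr do rewrite td_mulE big_distrr big_distrl /=.
under [RHS]eq_bigr do rewrite td_mulE !big_distrl /=.
rewrite [RHS]exchange_big /=; apply: eq_bigr => g _.
rewrite [RHS](reindex_inj (mulgI g)) /=; apply: eq_bigr => h _.
rewrite mulKg invMg gactM -!mulgA.
have := cocycleP alpha g h (h^-1 * (g^-1 * k))%g x; rewrite mulKVg => cP.
rewrite [X in _ = X * _]mulrAC -[RHS]mulrA cP [X in _ = _ * X]mulrC.
by rewrite !mulrA.
Qed.

Fact td_mul1 : left_id td_one td_mul.
Proof.
move=> a; apply/ffunP=> -[x k].
rewrite td_mulE (bigD1 1%g) //= big1 => [|g /negPf ng].
  by rewrite td_oneE eqxx mul1r invg1 mul1g gact1 cocycle1g mulr1 addr0.
by rewrite td_oneE ng !mul0r.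
Qed.

Fact td_mulr1 : right_id td_one td_mul.
Proof.
move=> a; apply/ffunP=> -[x k].
rewrite td_mulE (bigD1 k) //= big1 => [|g ng].
  by rewrite td_oneE mulVg eqxx mulr1 cocycleg1 mulr1 addr0.
by rewrite td_oneE -eq_mulVg1 (negPf ng) mulr0 mul0r.
Qed.

Fact td_mulDl : left_distributive td_mul +%R.
Proof.
move=> a b c; apply/ffunP=> -[x k]; rewrite [RHS]ffunE !td_mulE -big_split /=.
by apply: eq_bigr => g _; rewrite !ffunE !mulrDl.
Qed.

Fact td_mulDr : right_distributive td_mul +%R.
Proof.
move=> a b c; apply/ffunP=> -[x k]; rewrite [RHS]ffunE !td_mulE -big_split /=.
by apply: eq_bigr => g _; rewrite !ffunE mulrDr mulrDl.
Qed.

Fact td_1neq0 : td_one != 0.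
Proof.
have /card_gt0P[x _] := gset_nonempty X.
by apply/eqP=> /ffunP/(_ (x, 1%g))/eqP; rewrite td_oneE ffunE eqxx oner_eq0.
Qed.

HB.instance Definition _ := GRing.Zmodule_isNzRing.Build D
  td_mulA td_mul1 td_mulr1 td_mulDl td_mulDr td_1neq0.

Fact td_scalerAl (c : F) (a b : D) : c *: (a * b) = (c *: a) * b.
Proof.
apply/ffunP=> -[x k].
rewrite [LHS]ffunE [RHS]td_mulE [X in _ *: X]td_mulE scaler_sumr.
by apply: eq_bigr => g _; rewrite !ffunE !scalerAl.
Qed.

HB.instance Definition _ := GRing.Lmodule_isLalgebra.Build F D td_scalerAl.

Fact td_scalerAr (c : F) (a b : D) : c *: (a * b) = a * (c *: b).
Proof.
apply/ffunP=> -[x k].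
rewrite [LHS]ffunE [RHS]td_mulE [X in _ *: X]td_mulE scaler_sumr.
by apply: eq_bigr => g _; rewrite !ffunE scalerAl scalerAr.
Qed.

HB.instance Definition _ := GRing.Lalgebra_isAlgebra.Build F D td_scalerAr.
HB.instance Definition _ := Algebra_isFalgebra.Build F D.

Lemma td_basisM (x y : X) (g h : G) :
  td_basis x g * td_basis y h
  = (alpha g h x * (x == gact g y)%:R) *: td_basis x (g * h)%g.
Proof.
apply/ffunP=> -[z k]; rewrite [LHS]td_mulE (bigD1 g) //= big1 => [|u /negPf nu].
  rewrite !ffunE !xpair_eqE eqxx andbT addr0 /GRing.scale /=.
  have [->|_] := eqVneq z x; last by rewrite !mul0r mulr0.
  rewrite (can2_eq (gactKV g) (gactK g)) -(inj_eq (mulgI g)) mulKVg.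
  have [->|_] := eqVneq k (g * h)%g; last by rewrite andbF !(mulr0, mul0r).
  by rewrite mulKg andbT mul1r mulr1 mulrC.
by rewrite !ffunE xpair_eqE nu andbF !mul0r.
Qed.

End TwistedDouble.

(* Main.v *)
From HB Require Import structures.
From mathcomp Require Import finmap boolp classical_sets cardinality.
From mathcomp Require Import all_boot all_order all_algebra all_fingroup.
From mathcomp Require Import all_solvable all_field all_character.
From mathcomp Require Import reals complex.
From mathcomp Require Import ring.
Require Import Defs.

(** Write D for D_X^alpha(G), N for N_G(P) and F for the field of complex numbers.
The simple D-modules are found orbit by orbit.  For x in X the idempotent e(x) cuts out of D the corner
e(x) D e(x), which is the group algebra of the stabilizer G_x twisted by the
scalar cocycle alpha_x.  The map V |-> e(x) V is a bijection from the simple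
D-modules that e(x) does not kill to the irreducible projective
representations of G_x with cocycle alpha_x; its inverse is induction
([ind_exists], [corner_mod_iso]), which multiplies dimensions by the length of
the orbit of x.  So mu(D) is a sum over the orbits of length prime to p
([td_transversal]).  These are the orbits that contain a fixed point of P, for
G as for N, and two fixed points of P in one G-orbit lie in one N-orbit, by
Sylow's theorem in a stabilizer ([fixed_fusion]).  As N_x is the normalizer of
P in G_x, the theorem reduces to a McKay equality with a cocycle
([projective_mckay]): for P a Sylow p-subgroup of K and a cocycle b on K with
values in the units of F, the groups K and N_K(P) have the same number of
irreducible b-representations of degree prime to p.

If P has no b-representation of degree prime to p, both numbers are zero.
Otherwise induction from P to K yields a b-representation of K of a degree m
prime to p, and taking determinants shows that b^m is a coboundary; so b may
be replaced by a cohomologous cocycle with b^m = 1.  Writing b = zeta^c for a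
primitive m-th root of unity zeta, the additive cocycle c defines a central
extension E of K by Z/m.  The irreducible representations of E that lie over
the j-th character of Z/m are those of K with cocycle b^j
([ext_transversal]), and since p does not divide m, the normalizer in E of a
Sylow p-subgroup is the preimage of N_K(P) ([ext_sylow]).  The hypothesis on
ordinary group algebras, applied to E, therefore gives the sum over j of the
wanted equalities for the cocycles b^j.  The terms with gcd(j, m) > 1 agree by
induction on m.  The terms with j prime to m do not depend on j
([mode_count_conj]), on either side, and so they agree as well, among them the
term j = 1 ([mckay_roots_of_unity]).

That independence of j is a Galois conjugation, but no automorphism of F is
constructed.  The sum of all commutators of a finite group L acts on an
irreducible representation of degree d as the scalar (|L| / d)^2
([sum_commg_irr]), so a polynomial in it with rational coefficients selects
the degrees prime to p, with any rational weight.  The regular representation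
is rational; taking traces in it shows that, for z in the center of L, the sum
of the central characters at z over the irreducible representations of degree
prime to p is a rational number ([rational_mode_sum]).  By Fourier inversion
the number of such representations over the j-th character is the value at
zeta^(-j) of a polynomial over Q that does not depend on j, and a rational
polynomial that takes a rational value at one primitive m-th root of unity
takes it at all of them ([rat_root_prim_conj]). *)

Set Implicit Arguments.
Unset Strict Implicit.
Unset Printing Implicit Defensive.

Import GRing.Theory Num.Theory.
Local Open Scope ring_scope.

(** * Isomorphism classes and their representatives *)

Section Transversals.

(** Representatives are indexed by a type rather than listed, so that the
counts for two algebras can be compared by using one index type for both. *)
Definition transversal (T : Type) (P : T -> Prop) (E : T -> T -> Prop)
    (I : Type) (s : I -> T) : Prop :=
  [/\ forall i, P (s i), forall i j, E (s i) (s j) -> i = j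
    & forall x, P x -> exists i, E (s i) x].

Lemma transversal_le (T : Type) (P : T -> Prop) (E : T -> T -> Prop)
    (I J : finType) (s : I -> T) (t : J -> T) :
  (forall x y, E x y -> E y x) ->
  (forall x y z, E x y -> E y z -> E x z) ->
  transversal P E s -> transversal P E t -> (#|I| <= #|J|)%N.
Proof.
move=> Esym Etr [Ps Es _] [_ _ Ct].
have /choice[f fP] : forall i, exists j, E (t j) (s i) by move=> i; apply/Ct/Ps.
apply: (leq_card f) => i j fij; apply: Es; apply: Etr (fP j).
by rewrite -fij; apply: Esym.
Qed.

Lemma transversal_card (T : Type) (P : T -> Prop) (E : T -> T -> Prop)
    (I J : finType) (s : I -> T) (t : J -> T) :
  (forall x y, E x y -> E y x) ->
  (forall x y z, E x y -> E y z -> E x z) ->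
  transversal P E s -> transversal P E t -> #|I| = #|J|.
Proof.
move=> Esym Etr Ts Tt; apply/eqP; rewrite eqn_leq.
by rewrite (transversal_le Esym Etr Ts Tt) (transversal_le Esym Etr Tt Ts).
Qed.

Lemma eq_transversal (T : Type) (P P' : T -> Prop) (E : T -> T -> Prop) (I : Type)
    (s : I -> T) :
  (forall x, P x <-> P' x) -> transversal P E s -> transversal P' E s.
Proof. by move=> PP' [Ps Es Cs]; split=> // [i|x /PP']; [apply/PP'|apply: Cs]. Qed.

(** The form in which representatives are moved between categories: [h] plays
the part of an equivalence, full and faithful on isomorphism classes by the
fifth hypothesis and essentially surjective by the sixth. *)
Lemma transversal_comap (T T' : Type) (P : T -> Prop) (E : T -> T -> Prop)
    (P' : T' -> Prop) (E' : T' -> T' -> Prop) (h : T' -> T)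
    (I : Type) (s : I -> T) :
  (forall x y, E x y -> E y x) ->
  (forall x y z, E x y -> E y z -> E x z) ->
  (forall x y, P x -> E x y -> P y) ->
  (forall y, P' y <-> P (h y)) ->
  (forall y y', E' y y' <-> E (h y) (h y')) ->
  (forall x, P x -> exists y, E x (h y)) ->
  transversal P E s -> exists t : I -> T', transversal P' E' t.
Proof.
move=> Esym Etr PE P'P E'E hsurj [Ps Es Cs].
have /choice[t tP] : forall i, exists y, E (s i) (h y) by move=> i; apply/hsurj/Ps.
exists t; split=> [i|i j /E'E tij|y /P'P Py].
- by apply/P'P; apply: PE (Ps i) (tP i).
- by apply: Es; apply: Etr (tP i) (Etr _ _ _ tij (Esym _ _ (tP j))).
have [i iy] := Cs _ Py; exists i; apply/E'E.
exact: Etr (Esym _ _ (tP i)) iy.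
Qed.

Lemma transversal_ord (T : Type) (P : T -> Prop) (E : T -> T -> Prop)
    (I : finType) (s : I -> T) n : #|I| = n ->
  transversal P E s -> exists t : 'I_n -> T, transversal P E t.
Proof.
move=> <- [Ps Es Cs]; exists (s \o enum_val); split=> [i|i j /Es|x /Cs[i ix]] //=.
  exact: enum_val_inj.
by exists (enum_rank i); rewrite /= enum_rankK.
Qed.

End Transversals.

(** * Modules over a finite-dimensional algebra *)

Section Modules.
Variables (F : fieldType) (A : falgType F).
Implicit Types M : amodule A.

Lemma eq_mulmx_col (m n : nat) (B C : 'M[F]_(m, n)) :
  (forall v : 'cV_n, B *m v = C *m v) -> B = C.
Proof.
move=> BC; apply/matrixP=> i j.
by have /colP/(_ i) := BC (delta_mx j 0); rewrite -!colE !mxE.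
Qed.

Definition mod_mx M (a : A) : 'M[F]_((tag M).+1) := tagged M a.

Lemma mod_mxM M a b : mod_mx M (a * b) = mod_mx M a *m mod_mx M b.
Proof. exact: (rmorphM (tagged M)). Qed.

Lemma mod_mx1 M : mod_mx M 1 = 1%:M.
Proof. exact: (rmorph1 (tagged M)). Qed.

Lemma mod_mxD M a b : mod_mx M (a + b) = mod_mx M a + mod_mx M b.
Proof. exact: (raddfD (tagged M)). Qed.

Lemma mod_mxZ M c b : mod_mx M (c *: b) = c *: mod_mx M b.
Proof. by rewrite /mod_mx linearZ_LR. Qed.

(** The submodule generated by a nonzero vector is everything.  This form of
simplicity avoids subspaces and serves for all later arguments. *)
Lemma simple_modP M : simple_mod M <->
  forall v w : 'cV[F]_((tag M).+1), v != 0 -> exists a, mod_mx M a *m v = w.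
Proof.
split=> [simM v w v0|cycM U modU].
  pose h : A -> 'cV[F]_((tag M).+1) := fun a => mod_mx M a *m v.
  have h_lin : linear h.
    by move=> c a b; rewrite /h mod_mxD mod_mxZ mulmxDl scalemxAl.
  pose hL := HB.pack_for {linear A -> 'cV[F]_((tag M).+1)} h
    (GRing.isLinear.Build _ _ _ _ h h_lin).
  have := simM (limg (linfun hL)); case=> [||full].
  - move=> a u /memv_imgP[b _ ->]; apply/memv_imgP; exists (a * b).
      exact: memvf.
    by rewrite !lfunE /= /h /mod_act mod_mxM mulmxA.
  - move=> U0; have: v \in limg (linfun hL).
      apply/memv_imgP; exists 1; first exact: memvf.
      by rewrite lfunE /= /h mod_mx1 mul1mx.
    by rewrite U0 memv0 (negPf v0).
  have: w \in limg (linfun hL) by rewrite full memvf.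
  by case/memv_imgP=> a _; rewrite lfunE /=; exists a.
have [->|U0] := eqVneq U 0%VS; [by left | right].
have v0 : vpick U != 0 by rewrite vpick0.
 apply/eqP; rewrite eqEsubv subvf; apply/subvP=> w _.
by have [a <-] := cycM (vpick U) w v0; apply: modU; apply: memv_pick.
Qed.

Lemma mod_isoP M M' : mod_iso M M' <->
  exists B : 'M_((tag M').+1, (tag M).+1), exists B' : 'M_((tag M).+1, (tag M').+1),
    [/\ B *m B' = 1%:M, B' *m B = 1%:M
      & forall a, B *m mod_mx M a = mod_mx M' a *m B].
Proof.
split=> [[f [g fK gK] fP]|[B [B' [BB' B'B BP]]]].
  have g_lin : linear g.
    by move=> c u v; apply: (can_inj fK); rewrite linearP /= !gK.
  pose gL := HB.pack_for {linear 'cV[F]_((tag M').+1) -> 'cV[F]_((tag M).+1)} g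
    (GRing.isLinear.Build _ _ _ _ g g_lin).
  have lin_mxE (m n : nat) (h : {linear 'cV[F]_m -> 'cV[F]_n}) v :
      (\matrix_(i, j) h (delta_mx j 0) i 0) *m v = h v.
    rewrite [v in RHS]matrix_sum_delta linear_sum /=.
    apply/colP=> i; rewrite mxE summxE; apply: eq_bigr => j _.
    by rewrite big_ord1 linearZ !mxE mulrC.
  exists (\matrix_(i, j) f (delta_mx j 0) i 0).
  exists (\matrix_(i, j) gL (delta_mx j 0) i 0).
  split=> [||a]; apply: eq_mulmx_col => v; rewrite -!mulmxA !lin_mxE /= ?mul1mx ?fK ?gK //.
  exact: (fP a v).
pose f (v : 'cV[F]_((tag M).+1)) := B *m v.
pose fL := HB.pack_for {linear 'cV[F]_((tag M).+1) -> 'cV[F]_((tag M').+1)} f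
    (GRing.isLinear.Build _ _ _ _ f (fun c u v => linearP (mulmx B) c u v)).
exists fL; first by exists (mulmx B') => v; rewrite /= /f mulmxA ?BB' ?B'B mul1mx.
by move=> a v; rewrite /= /f /mod_act !mulmxA BP.
Qed.

Lemma mod_iso_refl M : mod_iso M M.
Proof. by apply/mod_isoP; exists 1%:M, 1%:M; split=> *; rewrite !(mul1mx, mulmx1). Qed.

Lemma mod_iso_sym M M' : mod_iso M M' -> mod_iso M' M.
Proof.
case/mod_isoP=> B [B' [BB' B'B BP]]; apply/mod_isoP; exists B', B; split=> // a.
by rewrite -[LHS]mulmx1 -BB' mulmxA -(mulmxA B') -BP !mulmxA B'B mul1mx.
Qed.

Lemma mod_iso_trans M1 M2 M3 : mod_iso M1 M2 -> mod_iso M2 M3 -> mod_iso M1 M3.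
Proof.
case/mod_isoP=> B [B' [BB' B'B BP]] /mod_isoP[C [C' [CC' C'C CP]]].
apply/mod_isoP; exists (C *m B), (B' *m C'); split=> [||a].
- by rewrite mulmxA -(mulmxA C) BB' mulmx1.
- by rewrite mulmxA -(mulmxA B') C'C mulmx1.
by rewrite -mulmxA BP mulmxA CP mulmxA.
Qed.

Lemma eq_dim_of_inv (m n : nat) (B : 'M[F]_(m, n)) (B' : 'M[F]_(n, m)) :
  B *m B' = 1%:M -> B' *m B = 1%:M -> m = n.
Proof.
move=> BB' B'B; apply/eqP; rewrite eqn_leq.
rewrite -{1}(mxrank1 F m) -BB' (leq_trans (mxrankM_maxr _ _)) ?rank_leq_row //=.
by rewrite -{1}(mxrank1 F n) -B'B (leq_trans (mxrankM_maxr _ _)) ?rank_leq_row.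
Qed.

Lemma mod_iso_dim M M' : mod_iso M M' -> mod_dim M = mod_dim M'.
Proof. by case/mod_isoP=> B [B' [BB' B'B _]]; apply/esym/(eq_dim_of_inv BB'). Qed.

Definition coprime_simple p M := simple_mod M /\ coprime (mod_dim M) p.

(** Turns the cardinality of a set of isomorphism classes into that of an
index type, which also supplies the finiteness of the set. *)
Lemma mu_transversal (p : nat) (I : finType) (s : I -> amodule A) :
  transversal (coprime_simple p) (@mod_iso F A) s -> mu A p = #|I|.
Proof.
move=> [Ps Es Cs]; rewrite /mu.
have cls_inj : injective (fun i => iso_class (s i)).
  move=> i j /(congr1 (fun S : set _ => S (s j))); rewrite /iso_class /= => ij.
  by apply: Es; rewrite ij; apply: mod_iso_refl.
have -> : @simple_classes_coprime F A p
    = ((fun i => iso_class (s i)) @` [set` [fset i | i in I]%fset])%classic.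
  apply/seteqP; split=> S /=.
    case=> M /Cs[i iM] <-; exists i; first by apply/imfsetP; exists i.
    apply/seteqP; split=> N; rewrite /iso_class /=.
      by move=> iN; apply: mod_iso_trans (mod_iso_sym iM) iN.
    by apply: mod_iso_trans iM.
  by case=> i _ <-; exists (s i) => //; apply: Ps.
rewrite fset_set_image; last exact: finite_fset.
rewrite set_fsetK card_imfset //= card_imfset //= -cardE.
by apply: eq_card => i; rewrite !inE.
Qed.

End Modules.

Section CyclicIso.
Variables (F : fieldType) (A : falgType F).

Lemma mod_mxN (M : amodule A) a : mod_mx M (- a) = - mod_mx M a.
Proof. exact: (raddfN (tagged M)). Qed.

Lemma mod_mx_sum (M : amodule A) I (r : seq I) P (f : I -> A) :
  mod_mx M (\sum_(i <- r | P i) f i) = \sum_(i <- r | P i) mod_mx M (f i).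
Proof. exact: (raddf_sum (tagged M)). Qed.

(** Since [v] generates [M], the map sending [a v] to [a v'] is defined on all
of [M], and it is well defined because the annihilator of [v] kills [v']. *)
Lemma cyclic_hom (M M' : amodule A) (v : 'cV_((tag M).+1))
    (v' : 'cV_((tag M').+1)) : simple_mod M -> v != 0 ->
    (forall a, mod_mx M a *m v = 0 -> mod_mx M' a *m v' = 0) ->
  exists B : 'M_((tag M').+1, (tag M).+1),
    forall a, B *m (mod_mx M a *m v) = mod_mx M' a *m v'.
Proof.
move=> /simple_modP simM v0 vv'.
have /choice[a aP] j := simM v (delta_mx j 0) v0.
exists (\matrix_(i, j) (mod_mx M' (a j) *m v') i 0) => b.
set u := mod_mx M b *m v.
have ub : mod_mx M (\sum_j u j 0 *: a j - b) *m v = 0.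
  rewrite mod_mxD mod_mxN mod_mx_sum mulmxBl -/u.
  rewrite mulmx_suml [X in _ - X]matrix_sum_delta.
  apply/eqP; rewrite subr_eq0; apply/eqP/eq_bigr => j _.
  by rewrite mod_mxZ -scalemxAl aP big_ord1.
move/vv': ub; rewrite mod_mxD mod_mxN mod_mx_sum mulmxBl.
move/eqP; rewrite subr_eq0 => /eqP <-; rewrite mulmx_suml.
apply/colP=> i; rewrite mxE summxE; apply: eq_bigr => j _.
by rewrite mod_mxZ -scalemxAl !mxE mulrC.
Qed.

(** In a simple module the annihilator of a nonzero vector is a maximal left
ideal, so an inclusion between two of them is an equality, and both modules
are the quotient of [A] by it. *)
Lemma cyclic_iso (M M' : amodule A) (v : 'cV_((tag M).+1))
    (v' : 'cV_((tag M').+1)) :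
    simple_mod M -> simple_mod M' -> v != 0 -> v' != 0 ->
    (forall a, mod_mx M a *m v = 0 -> mod_mx M' a *m v' = 0) ->
  mod_iso M M'.
Proof.
move=> simM simM' v0 v'0 vv'.
have [B BP] := cyclic_hom simM v0 vv'.
have [a av'|B' B'P] := @cyclic_hom M' M v' v simM' v'0.
  apply/eqP; apply: contraNT v'0 => av0.
  have [b bP] := (simple_modP M).1 simM _ v av0.
  have : mod_mx M (b * a - 1) *m v = 0.
    by rewrite mod_mxD mod_mxN mod_mxM mod_mx1 mulmxBl -mulmxA bP mul1mx subrr.
  move/vv'; rewrite mod_mxD mod_mxN mod_mxM mod_mx1 mulmxBl -mulmxA av' mulmx0.
  by rewrite mul1mx sub0r => /eqP; rewrite oppr_eq0.
apply/mod_isoP; exists B, B'; split=> [||b]; apply: eq_mulmx_col => w.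
- have [a <-] := (simple_modP M').1 simM' _ w v'0.
  by rewrite -mulmxA B'P BP mul1mx.
- have [a <-] := (simple_modP M).1 simM _ w v0.
  by rewrite -mulmxA BP B'P mul1mx.
have [a <-] := (simple_modP M).1 simM _ w v0.
by rewrite -!mulmxA (BP a) (mulmxA (mod_mx M b)) -mod_mxM BP mod_mxM -mulmxA.
Qed.

End CyclicIso.

(** * Projective representations *)

Section ProjectiveReps.
Variables (F : fieldType) (gT : finGroupType).

(** Bare families of matrices: the cocycle and the subset of the group on which
the family multiplies projectively are left to [is_prep], so that one family
can be read over several subgroups. *)
Definition prep : Type := {n : nat & gT -> 'M[F]_n.+1}.
Implicit Types (A : {set gT}) (b : gT -> gT -> F) (W : prep).

Definition prep_mx W (g : gT) : 'M[F]_((tag W).+1) := tagged W g.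

Definition is_prep A b W : Prop :=
  prep_mx W 1%g = 1%:M /\
  {in A &, forall g h, prep_mx W g *m prep_mx W h = b g h *: prep_mx W (g * h)%g}.

(** Irreducibility in the generating form of [simple_modP]. *)
Definition prep_irr A W : Prop := forall v w : 'cV[F]_((tag W).+1), v != 0 ->
  exists c : gT -> F, \sum_(g in A) c g *: prep_mx W g *m v = w.

(** The objects counted on the group side: irreducible projective
representations with cocycle [b] whose degree is prime to [p]. *)
Definition pirr p A b W : Prop :=
  [/\ is_prep A b W, prep_irr A W & coprime (tag W).+1 p].

Definition piso A W W' : Prop :=
  exists B : 'M_((tag W').+1, (tag W).+1), exists B' : 'M_((tag W).+1, (tag W').+1),
    [/\ B *m B' = 1%:M, B' *m B = 1%:M
      & {in A, forall g, B *m prep_mx W g = prep_mx W' g *m B}].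

Lemma piso_refl A W : piso A W W.
Proof. by exists 1%:M, 1%:M; split=> [||g _]; rewrite ?mulmx1 ?mul1mx. Qed.

Lemma piso_sym A W W' : piso A W W' -> piso A W' W.
Proof.
case=> B [B' [BB' B'B BP]]; exists B', B; split=> // a Aa.
by rewrite -[LHS]mulmx1 -BB' mulmxA -(mulmxA B') -BP // !mulmxA B'B mul1mx.
Qed.

Lemma piso_trans A W1 W2 W3 : piso A W1 W2 -> piso A W2 W3 -> piso A W1 W3.
Proof.
case=> B [B' [BB' B'B BP]] [C [C' [CC' C'C CP]]].
exists (C *m B), (B' *m C'); split=> [||a Aa].
- by rewrite mulmxA -(mulmxA C) BB' mulmx1.
- by rewrite mulmxA -(mulmxA B') C'C mulmx1.
by rewrite -mulmxA BP // mulmxA CP // mulmxA.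
Qed.

Lemma piso_dim A W W' : piso A W W' -> tag W = tag W'.
Proof. by case=> B [B' [BB' B'B _]]; apply/esym/succn_inj/(eq_dim_of_inv BB'). Qed.

End ProjectiveReps.

Section PrepTransfer.
Variable F : fieldType.

Lemma pirr_piso (gT : finGroupType) p (A : {group gT}) b (W W' : prep F gT) :
  pirr p A b W -> piso A W W' -> pirr p A b W'.
Proof.
move=> [[W1 WM] Wirr cop] isoW; have [B [B' [BB' B'B BP]]] := isoW.
have W'E g : g \in A -> prep_mx W' g = B *m prep_mx W g *m B'.
  by move=> Ag; rewrite BP // -mulmxA BB' mulmx1.
split; last by rewrite -(piso_dim isoW).
  split=> [|g h Ag Ah]; first by rewrite W'E ?group1 // W1 mulmx1.
  rewrite !W'E ?groupM // !mulmxA -(mulmxA _ B' B) B'B mulmx1.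
  by rewrite -(mulmxA B) WM // -scalemxAr -scalemxAl.
move=> v w v0; have v0' : B' *m v != 0.
  by apply: contraNneq v0 => v0; rewrite -[v]mul1mx -BB' -mulmxA v0 mulmx0.
have [c cP] := Wirr _ (B' *m w) v0'; exists c.
rewrite -[w]mul1mx -BB' -mulmxA -cP mulmx_sumr; apply: eq_bigr => g Ag.
by rewrite W'E // -!scalemxAl -scalemxAr !mulmxA.
Qed.

Definition prep_pull (aT rT : finGroupType) (f : aT -> rT) (W : prep F rT) :
  prep F aT := existT _ (tag W) (fun x => prep_mx W (f x)).

(** An isomorphism between subgroups of two ambient groups, as a pair of total
maps, so that it can be composed with families defined on the ambient groups. *)
Definition iso_on (aT rT : finGroupType) (A : {set aT}) (B : {set rT})
    (f : aT -> rT) (g : rT -> aT) : Prop :=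
  [/\ {in A, forall x, f x \in B}, {in B, forall y, g y \in A},
      {in A, cancel f g}, {in B, cancel g f}
    & {in A &, {morph f : x y / (x * y)%g}}].

Lemma iso_on_sym (aT rT : finGroupType) (A : {group aT}) (B : {group rT}) f g :
  iso_on A B f g -> iso_on B A g f.
Proof.
case=> fA gB fK gK fM; split=> // x y Bx By.
by rewrite -{1}[x]gK // -{1}[y]gK // -fM ?gB // fK // groupM ?gB.
Qed.

Lemma pirr_pull (aT rT : finGroupType) p (A : {group aT}) (B : {group rT}) f g
    a b (W : prep F rT) :
  iso_on A B f g -> {in A &, forall x y, a x y = b (f x) (f y)} ->
  pirr p B b W -> pirr p A a (prep_pull f W).
Proof.
case=> fA gB fK gK fM ab [[W1 WM] Wirr cop].
have f1 : f 1%g = 1%g.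
  by apply: (mulgI (f 1%g)); rewrite mulg1 -fM ?group1 // mulg1.
split=> //; first split=> [|x y Ax Ay].
- by rewrite /prep_mx /= f1.
- by rewrite /prep_mx /= fM // ab // -WM ?fA.
move=> v w v0; have [c cP] := Wirr v w v0; exists (fun x => c (f x)).
rewrite -cP [RHS](reindex_onto f g) => [|y By]; last exact: gK.
apply: eq_bigl => x; apply/idP/andP => [Ax|[fx /eqP<-]]; last exact: gB.
by rewrite fA // fK.
Qed.

Lemma transversal_pull (aT rT : finGroupType) p (A : {group aT}) (B : {group rT})
    f g a b (I : Type) (s : I -> prep F rT) :
  iso_on A B f g -> {in A &, forall x y, a x y = b (f x) (f y)} ->
  transversal (pirr p B b) (piso B) s ->
  exists t : I -> prep F aT, transversal (pirr p A a) (piso A) t.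
Proof.
move=> fg ab; have gf := iso_on_sym fg; have [fA gB fK gK fM] := fg.
have ba : {in B &, forall x y, b x y = a (g x) (g y)}.
  by move=> x y Bx By; rewrite ab ?gB // !gK.
apply: (@transversal_comap _ _ _ _ _ _ (prep_pull g)).
- exact: piso_sym.
- exact: piso_trans.
- exact: pirr_piso.
- move=> W; split=> [|gW]; first exact: pirr_pull gf ba.
  apply: (@pirr_piso _ p A a (prep_pull f (prep_pull g W))).
    exact: pirr_pull fg ab gW.
  exists 1%:M, 1%:M; split=> [||x Ax]; rewrite ?mul1mx ?mulmx1 //.
  by rewrite /prep_mx /= /prep_mx /= fK.
- move=> W W'; split=> -[C [C' [CC' C'C CP]]]; exists C, C'; split=> // x Ax.
    by rewrite /prep_mx /=; apply: CP; apply: gB.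
  by have := CP (f x) (fA x Ax); rewrite /prep_mx /= /prep_mx fK.
move=> W _; exists (prep_pull f W).
exists 1%:M, 1%:M; split=> [||x Ax]; rewrite ?mul1mx ?mulmx1 //.
by rewrite /prep_mx /= /prep_mx /= gK.
Qed.

Definition prep_scale (gT : finGroupType) (c : gT -> F) (W : prep F gT) : prep F gT :=
  existT _ (tag W) (fun x => c x *: prep_mx W x).

Lemma pirr_scale (gT : finGroupType) p (A : {group gT}) a b c (W : prep F gT) :
  (forall x, c x != 0) -> c 1%g = 1 ->
  (forall x y, a x y * c (x * y)%g = c x * c y * b x y) ->
  pirr p A b W -> pirr p A a (prep_scale c W).
Proof.
move=> c0 c1 ab [[W1 WM] Wirr cop]; split=> //; first split=> [|x y Ax Ay].
- by rewrite /prep_mx /= c1 scale1r.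
- by rewrite /prep_mx /= -scalemxAl -scalemxAr !scalerA ab WM // scalerA.
move=> v w v0; have [d dP] := Wirr v w v0; exists (fun x => d x / c x).
by rewrite -dP; apply: eq_bigr => x _; rewrite /prep_mx /= scalerA divfK.
Qed.

(** Cohomologous cocycles have the same representation theory: rescaling by
[c] changes the cocycle by the coboundary of [c]. *)
Lemma transversal_scale (gT : finGroupType) p (A : {group gT}) a b c
    (I : Type) (s : I -> prep F gT) :
  (forall x, c x != 0) -> c 1%g = 1 ->
  (forall x y, a x y * c (x * y)%g = c x * c y * b x y) ->
  transversal (pirr p A b) (piso A) s ->
  exists t : I -> prep F gT, transversal (pirr p A a) (piso A) t.
Proof.
move=> c0 c1 ab; pose d x := (c x)^-1.
have d0 x : d x != 0 by rewrite invr_eq0.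
have d1 : d 1%g = 1 by rewrite /d c1 invr1.
have ba x y : b x y * d (x * y)%g = d x * d y * a x y.
  apply: (mulfI (mulf_neq0 (c0 x) (c0 y))); rewrite mulrA -ab mulfK //.
  by rewrite mulrA /d -invfM mulfV ?mul1r ?mulf_neq0.
have scale2 e e' W : (forall x, e x * e' x = 1) ->
    piso A (prep_scale e (prep_scale e' W)) W.
  move=> ee'; exists 1%:M, 1%:M; split=> [||x Ax]; rewrite ?mul1mx ?mulmx1 //.
  by rewrite /prep_mx /= /prep_mx /= scalerA ee' scale1r.
have cd x : c x * d x = 1 by rewrite mulfV.
have dc x : d x * c x = 1 by rewrite mulVf.
apply: (@transversal_comap _ _ _ _ _ _ (prep_scale d)).
- exact: piso_sym.
- exact: piso_trans.
- exact: pirr_piso.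
- move=> W; split=> [|gW]; first exact: pirr_scale d0 d1 ba.
  exact: pirr_piso (pirr_scale c0 c1 ab gW) (scale2 _ _ _ cd).
- move=> W W'; split=> -[C [C' [CC' C'C CP]]]; exists C, C'; split=> // x Ax.
    by rewrite /prep_mx /= -scalemxAr -scalemxAl CP.
  have := CP x Ax; rewrite /prep_mx /= -scalemxAr -scalemxAl.
  exact: scalerI.
move=> W _; exists (prep_scale c W); exact/piso_sym/scale2.
Qed.

End PrepTransfer.

(** * Modules over the twisted double from its basis *)

Section Doubles.
Variables (F : fieldType) (G : finGroupType) (X : gset G) (alpha : cocycle F X).
Local Notation D := (twisted_double alpha).
Local Notation tdb := (td_basis alpha).

Lemma td_sum (a : D) : a = \sum_x \sum_g a (x, g) *: tdb x g.
Proof.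
apply/ffunP=> -[x g]; rewrite sum_ffunE (bigD1 x) //= [X in _ + X]big1 ?addr0.
  rewrite sum_ffunE (bigD1 g) //= [X in _ + X]big1 ?addr0.
    by rewrite !ffunE eqxx /GRing.scale /= mulr1.
  by move=> h hg; rewrite !ffunE xpair_eqE [g == h]eq_sym (negPf hg) andbF scaler0.
move=> y yx; rewrite sum_ffunE big1 // => h _.
by rewrite !ffunE xpair_eqE [x == y]eq_sym (negPf yx) scaler0.
Qed.

Section TdModule.
Variables (n : nat) (T : X -> G -> 'M[F]_n.+1).
Hypothesis TM : forall x y g h,
  T x g *m T y h = (alpha g h x * (x == gact g y)%:R) *: T x (g * h)%g.
Hypothesis T1 : \sum_x T x 1%g = 1%:M.

(** The linear extension of prescribed images of the basis; the two hypotheses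
of the section make it multiplicative and unital. *)
Definition td_rep (a : D) : 'M[F]_n.+1 := \sum_x \sum_g a (x, g) *: T x g.

Lemma td_rep_basis x g : td_rep (tdb x g) = T x g.
Proof.
rewrite /td_rep (bigD1 x) //= [X in _ + X]big1 ?addr0.
  rewrite (bigD1 g) //= [X in _ + X]big1 ?addr0.
    by rewrite ffunE eqxx scale1r.
  by move=> h hg; rewrite ffunE xpair_eqE (negPf hg) andbF scale0r.
move=> y yx; rewrite big1 // => h _.
by rewrite ffunE xpair_eqE (negPf yx) scale0r.
Qed.

Lemma td_repZ c a : td_rep (c *: a) = c *: td_rep a.
Proof.
rewrite /td_rep scaler_sumr; apply: eq_bigr => x _; rewrite scaler_sumr.
by apply: eq_bigr => g _; rewrite ffunE -scalerA.
Qed.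

Fact td_rep_linear : linear td_rep.
Proof.
move=> c a b; rewrite /td_rep scaler_sumr -big_split; apply: eq_bigr => x _ /=.
rewrite scaler_sumr -big_split; apply: eq_bigr => g _ /=.
by rewrite !ffunE scalerDl scalerA.
Qed.

HB.instance Definition _ := GRing.isLinear.Build F D 'M[F]_n.+1 _ td_rep td_rep_linear.

Fact td_rep_monoid : monoid_morphism td_rep.
Proof.
split.
  rewrite -[RHS]T1 -[1]/(td_one alpha) /td_one raddf_sum.
  by apply: eq_bigr => x _; rewrite -[RHS]td_rep_basis.
move=> a b; rewrite [in LHS](td_sum a) [in LHS](td_sum b).
rewrite mulr_suml raddf_sum [td_rep a]/td_rep mulr_suml; apply: eq_bigr => x _.
rewrite !mulr_suml raddf_sum; apply: eq_bigr => g _.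
rewrite !mulr_sumr raddf_sum; apply: eq_bigr => y _.
rewrite !mulr_sumr raddf_sum; apply: eq_bigr => h _.
rewrite -scalerAl -scalerAr td_basisM [LHS]td_repZ !td_repZ td_rep_basis.
by rewrite -scalerAl -scalerAr -[T x g * T y h]/(T x g *m T y h) TM.
Qed.

HB.instance Definition _ := GRing.isMonoidMorphism.Build D 'M[F]_n.+1 td_rep td_rep_monoid.

Definition td_module : amodule D := existT _ n (td_rep : {lrmorphism D -> 'M[F]_n.+1}).

End TdModule.

End Doubles.

(** * Orbits, stabilizers and Sylow subgroups *)

Section OrbitsStabilizers.
Variables (G : finGroupType) (X : gset G).

Definition stab (x : X) : {set G} := [set g | gact g x == x].

Lemma stabP x g : reflect (gact g x = x) (g \in stab x).
Proof. by rewrite inE; apply: eqP. Qed.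

Fact stab_group_set x : group_set (stab x).
Proof.
apply/group_setP; split=> [|g h /stabP gx /stabP hx]; first by apply/stabP/gact1.
by apply/stabP; rewrite gactM hx.
Qed.
Canonical stab_group x := Group (stab_group_set x).

Definition orb (x : X) : {set X} := [set gact g x | g : G].

Lemma orbP x y : reflect (exists g, gact g x = y) (y \in orb x).
Proof. by apply: (iffP imsetP) => [[g _ ->]|[g <-]]; exists g. Qed.

Lemma orb_refl x : x \in orb x.
Proof. by apply/orbP; exists 1%g; rewrite gact1. Qed.

Lemma orb_sym x y : y \in orb x -> x \in orb y.
Proof. by case/orbP=> g <-; apply/orbP; exists g^-1%g; rewrite -gactM mulVg gact1. Qed.

Lemma orb_trans x y z : y \in orb x -> z \in orb y -> z \in orb x.
Proof.
by case/orbP=> g <- /orbP[h <-]; apply/orbP; exists (h * g)%g; rewrite gactM.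
Qed.

Lemma orb_act x y g : (gact g y \in orb x) = (y \in orb x).
Proof.
apply/idP/idP => [gy|yx]; last by apply: orb_trans yx _; apply/orbP; exists g.
by apply: orb_trans gy (orb_sym _); apply/orbP; exists g.
Qed.

(** A choice of [g] with [g x = y] for [y] in the orbit of [x].  The choice
[1] for [y = x] makes induction restrict to the identity on the block of [x]. *)
Definition transporter (x y : X) : G :=
  if y == x then 1%g else odflt 1%g [pick g | gact g x == y].

Lemma transporterP x y : y \in orb x -> gact (transporter x y) x = y.
Proof.
rewrite /transporter => /orbP[g gx]; have [->|_] := eqVneq; first by rewrite gact1.
by case: pickP => [h /eqP//|/(_ g)]; rewrite gx eqxx.
Qed.

Lemma transporter1 x : transporter x x = 1%g. Proof. by rewrite /transporter eqxx. Qed.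

End OrbitsStabilizers.

Section OrbitCounting.
Variables (G : finGroupType) (X : gset G) (p : nat).
Hypothesis p_prime : prime p.

(** The right action attached to the left action, to which orbit counting
applies. *)
Definition gset_to (x : X) (g : G) : X := gact g^-1%g x.

Fact gset_to_is_action : is_action [set: G] gset_to.
Proof.
split=> [g|x g h _ _]; last by rewrite /gset_to invMg gactM.
by apply: (can_inj (g := gact g)) => x; rewrite /gset_to gactKV.
Qed.
Canonical gset_action := Action gset_to_is_action.

Lemma orbit_gset (x : X) : orbit gset_action [set: G] x = orb x.
Proof.
apply/setP=> y; apply/orbitP/orbP=> [[g _ <-]|[g <-]]; first by exists g^-1%g.
by exists g^-1%g; rewrite ?inE //= /gset_to invgK.
Qed.

Variable S : {group G}.
Hypothesis sylS : (p.-Sylow([set: G]) S)%g.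

(** The number of fixed points of a p-group is congruent to the length of the
orbit modulo p. *)
Lemma fixed_point_of_orb (x : X) : coprime #|orb x| p ->
  exists2 y : X, y \in orb x & forall g, g \in S -> gact g y = y.
Proof.
move=> cop; have actS : [acts S, on orb x | gset_action].
  apply/subsetP=> g _; rewrite !inE /=; apply/subsetP=> y yx.
  by rewrite inE /= /gset_to orb_act.
have := pgroup_fix_mod (pHall_pgroup sylS) actS.
have [->|/set0Pn[y /setIP[yx /afixP yfix]]] :=
    eqVneq 'Fix_(orb x | gset_action)(S)%g set0.
  rewrite cards0 mod0n => /eqP; rewrite -/(dvdn _ _).
  by rewrite coprime_sym prime_coprime // in cop; rewrite (negPf cop).
move=> _; exists y => // g Sg.
by have := yfix g^-1%g (groupVr Sg); rewrite /= /gset_to invgK.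
Qed.

(** The length of the orbit is the index of the stabilizer, which divides the
index of the Sylow subgroup that it contains. *)
Lemma coprime_orb_fixed (x : X) : (forall g, g \in S -> gact g x = x) ->
  coprime #|orb x| p.
Proof.
move=> fixx; rewrite -orbit_gset card_orbit.
have sSC : S \subset 'C_[set: G][x | gset_action]%g.
  apply/subsetP=> g Sg; rewrite 2!inE /=; apply/astab1P.
  by rewrite /= /gset_to fixx ?groupV.
have /and3P[_ _ p'index] := sylS.
rewrite coprime_sym prime_coprime // -p'natE //.
exact: pnat_dvd (indexgS _ sSC) p'index.
Qed.

End OrbitCounting.

(** * Induction from a stabilizer *)

(** A space of dimension [#|A| * d.+1] split into blocks of dimension [d.+1]
indexed by [A].  The injections and projections are indexed by the whole of
[X], with zero injections outside [A], which spares the later formulas any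
membership test. *)
Lemma biproduct (F : fieldType) (X : finType) (A : {set X}) (d : nat) :
  (0 < #|A|)%N ->
  exists2 n : nat, n.+1 = (#|A| * d.+1)%N &
  exists inj : X -> 'M[F]_(n.+1, d.+1), exists pr : X -> 'M[F]_(d.+1, n.+1),
    [/\ forall x, x \notin A -> inj x = 0,
        forall x, x \in A -> pr x *m inj x = 1%:M,
        forall x y, x != y -> pr x *m inj y = 0
      & \sum_x inj x *m pr x = 1%:M].
Proof.
move=> A0; pose B := setX A [set: 'I_d.+1].
have cardB : #|B| = (#|A| * d.+1)%N by rewrite cardsX cardsT card_ord.
have Bn : (#|A| * d.+1).-1.+1 = #|B| by rewrite cardB prednK // muln_gt0 A0.
exists (#|A| * d.+1).-1; first by rewrite Bn.
pose e (k : 'I_(#|A| * d.+1).-1.+1) : X * 'I_d.+1 := enum_val (cast_ord Bn k).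
have e_inj : injective e by move=> k l /enum_val_inj/cast_ord_inj.
have eB k : e k \in B by apply: enum_valP.
have eP z : z \in B -> exists k, e k = z.
  move=> Bz; exists (cast_ord (esym Bn) (enum_rank_in Bz z)).
  by rewrite /e cast_ordKV enum_rankK_in.
exists (fun x => \matrix_(k, a) (e k == (x, a))%:R).
exists (fun x => \matrix_(a, k) (e k == (x, a))%:R).
split=> [x xA|x xA|x y xy|].
- apply/matrixP=> k a; rewrite !mxE; case: eqP => // ek.
  by have := eB k; rewrite ek inE (negPf xA).
- apply/matrixP=> a c; rewrite !mxE.
  have [|k kP] := eP (x, a); first by rewrite !inE xA.
  rewrite (bigD1 k) //= big1 => [|l lk]; rewrite !mxE.
    by rewrite kP eqxx mul1r addr0 xpair_eqE eqxx.
  by rewrite -kP (inj_eq e_inj) (negPf lk) mul0r.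
- apply/matrixP=> a c; rewrite !mxE big1 // => k _; rewrite !mxE.
  have [->|_] := eqVneq; last by rewrite mul0r.
  by rewrite xpair_eqE (negPf xy) mulr0.
apply/matrixP=> k l; rewrite summxE mxE (bigD1 (e k).1) //= [X in _ + X]big1.
  rewrite addr0 mxE (bigD1 (e k).2) //= big1 => [|a ak]; rewrite !mxE.
    by rewrite -surjective_pairing eqxx mul1r addr0 eq_sym (inj_eq e_inj).
  case: eqP => [ek|_]; last by rewrite mul0r.
  by rewrite ek eqxx in ak.
move=> x xk; rewrite mxE big1 // => a _; rewrite !mxE.
case: eqP => [ek|_]; last by rewrite mul0r.
by rewrite ek eqxx in xk.
Qed.

Section Corner.
Variables (F : fieldType) (G : finGroupType) (X : gset G) (alpha : cocycle F X).
Local Notation D := (twisted_double alpha).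
Local Notation tdb := (td_basis alpha).

Definition stab_cocycle (x : X) (g h : G) : F := alpha g h x.

(** [W] is the representation of the stabilizer of [x] on the space e(x) M:
[C] and [R] are the inclusion of the image of the idempotent e(x) and the
projection onto it. *)
Definition corner (x : X) (M : amodule D) (W : prep F G) : Prop :=
  exists C : 'M[F]_((tag M).+1, (tag W).+1),
  exists R : 'M[F]_((tag W).+1, (tag M).+1),
  [/\ R *m C = 1%:M, C *m R = mod_mx M (tdb x 1%g)
    & {in stab x, forall g, R *m mod_mx M (tdb x g) *m C = prep_mx W g}].

Section Induction.
Variables (x0 : X) (W : prep F G).
Hypothesis Wrep : is_prep (stab x0) (stab_cocycle x0) W.
Variables (n : nat) (inj : X -> 'M[F]_(n.+1, (tag W).+1))
  (pr : X -> 'M[F]_((tag W).+1, n.+1)).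
Hypothesis inj0 : forall x, x \notin orb x0 -> inj x = 0.
Hypothesis pr_inj1 : forall x, x \in orb x0 -> pr x *m inj x = 1%:M.
Hypothesis pr_inj0 : forall x y, x != y -> pr x *m inj y = 0.
Hypothesis sum_inj_pr : \sum_x inj x *m pr x = 1%:M.

Local Notation s := (transporter x0).

(** In the module induced from the stabilizer of [x0] to D, the basis element
e(x) (x) g maps the block of [g^-1 x] to the block of [x]; on the chosen
coset representatives it acts through this element of the stabilizer. *)
Definition ind_elt (x : X) (g : G) : G := ((s x)^-1 * g * s (gact g^-1 x))%g.

(** The scalar that appears when the product of [g] with the representative of
the block [g^-1 x] is rewritten as the representative of the block [x] times
[ind_elt x g]. *)
Definition ind_coef (x : X) (g : G) : F :=
  alpha g (s (gact g^-1%g x)) x / alpha (s x) (ind_elt x g) x.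

Definition ind_mx (x : X) (g : G) : 'M[F]_n.+1 :=
  ind_coef x g *: (inj x *m prep_mx W (ind_elt x g) *m pr (gact g^-1%g x)).

Lemma ind_coef_neq0 x g : ind_coef x g != 0.
Proof. by rewrite mulf_neq0 ?invr_eq0 ?cocycle_unit. Qed.

Lemma ind_elt_stab x g : x \in orb x0 -> ind_elt x g \in stab x0.
Proof.
move=> xO; apply/stabP; rewrite /ind_elt 2!gactM transporterP; last by rewrite orb_act.
by rewrite gactKV -[in RHS](gactK (s x) x0) transporterP.
Qed.

Lemma ind_eltM x g h :
  (ind_elt x g * ind_elt (gact g^-1 x) h)%g = ind_elt x (g * h)%g.
Proof. by rewrite /ind_elt invMg gactM !mulgA mulgK. Qed.

(** Associativity of the induced module at the level of scalars: it combines
three instances of the cocycle identity. *)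
Lemma ind_coefM x g h : x \in orb x0 ->
  ind_coef x g * ind_coef (gact g^-1%g x) h
    * alpha (ind_elt x g) (ind_elt (gact g^-1%g x) h) x0
  = alpha g h x * ind_coef x (g * h)%g.
Proof.
move=> xO; rewrite /ind_coef -ind_eltM invMg gactM.
set y := gact g^-1%g x; set z := gact h^-1%g y.
set h1 := ind_elt x g; set h2 := ind_elt y h.
have P1 := cocycleP alpha g h (s z) x.
have P2 := cocycleP alpha g (s y) h2 x.
have P3 := cocycleP alpha (s x) h1 h2 x.
rewrite -/y in P1 P2.
have sxh1 : (s x * h1 = g * s y)%g by rewrite /h1 /ind_elt !mulgA mulgV mul1g.
have syh2 : (s y * h2 = h * s z)%g by rewrite /h2 /ind_elt !mulgA mulgV mul1g.
have sx0 : gact (s x)^-1%g x = x0 by rewrite -[X in gact _ X](transporterP xO) gactK.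
rewrite sxh1 sx0 in P3; rewrite syh2 in P2.
have nz g' h' x' : alpha g' h' x' != 0 by apply: cocycle_unit.
(* the scalars to be eliminated, expressed through the three identities *)
have A2 : alpha g (s y) x = alpha g (h * s z)%g x * alpha (s y) h2 y
    / alpha (g * s y)%g h2 x by rewrite -P2 mulfK.
have A3 : alpha h1 h2 x0 = alpha (s x) h1 x * alpha (g * s y)%g h2 x
    / alpha (s x) (h1 * h2)%g x by rewrite P3 mulrAC mulfV ?mul1r.
have A1 : alpha g h x = alpha g (h * s z)%g x * alpha h (s z) y
    / alpha (g * h)%g (s z) x by rewrite -P1 mulfK.
rewrite A1 A2 A3; field.
by rewrite !nz.
Qed.

Lemma ind_mxM x y g h :
  ind_mx x g *m ind_mx y h
  = (alpha g h x * (x == gact g y)%:R) *: ind_mx x (g * h)%g.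
Proof.
rewrite /ind_mx -scalemxAl -scalemxAr !mulmxA.
rewrite -(mulmxA _ (pr _) (inj y)).
have [xgy|xgy] := eqVneq x (gact g y); last first.
  rewrite pr_inj0 ?mulmx0 ?mul0mx ?scaler0 ?mulr0 ?scale0r //.
  by apply: contraNneq xgy => <-; rewrite gactKV.
have yE : gact g^-1%g x = y by rewrite xgy gactK.
have [xO|xO] := boolP (x \in orb x0); last first.
  by rewrite (inj0 xO) !mul0mx !scaler0.
have yO : y \in orb x0 by rewrite -yE orb_act.
rewrite yE pr_inj1 // mulmx1 -(mulmxA (inj x) (prep_mx W _) (prep_mx W _)) Wrep.2; last 2 first.
- exact: ind_elt_stab.
- exact: ind_elt_stab.
rewrite -scalemxAr -scalemxAl !scalerA mulr1 invMg gactM yE.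
rewrite -[in ind_elt y h]yE ind_eltM -ind_coefM // yE.
by rewrite mulrA.
Qed.

Lemma ind_mx_sum1 : \sum_x ind_mx x 1%g = 1%:M.
Proof.
rewrite -sum_inj_pr; apply: eq_bigr => x _.
rewrite /ind_mx /ind_coef /ind_elt invg1 gact1 mulg1 mulVg.
by rewrite cocycle1g cocycleg1 divr1 scale1r Wrep.1 mulmx1.
Qed.

Definition ind_module : amodule D := td_module ind_mxM ind_mx_sum1.

Lemma ind_module_basis x g : mod_mx ind_module (tdb x g) = ind_mx x g.
Proof. exact: td_rep_basis. Qed.

Lemma ind_module_corner : corner x0 ind_module W.
Proof.
have x0O := orb_refl x0.
exists (inj x0), (pr x0); split=> [||g /stabP gx0]; first exact: pr_inj1.
  rewrite ind_module_basis /ind_mx /ind_coef /ind_elt invg1 gact1 transporter1.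
  by rewrite invg1 !mulg1 cocycle1g divr1 scale1r Wrep.1 mulmx1.
have gx0' : gact g^-1%g x0 = x0 by rewrite -[X in gact _ X]gx0 gactK.
rewrite ind_module_basis /ind_mx /ind_coef /ind_elt gx0' transporter1 invg1 mul1g mulg1.
rewrite cocycle1g cocycleg1 divr1 scale1r -!mulmxA pr_inj1 // mulmx1.
by rewrite mulmxA pr_inj1 // mul1mx.
Qed.

Lemma ind_module_support x : mod_mx ind_module (tdb x 1%g) != 0 -> x \in orb x0.
Proof.
by apply: contraR => xO; rewrite ind_module_basis /ind_mx inj0 // !mul0mx scaler0.
Qed.

(** A nonzero vector has a nonzero component in some block.  From there the
elements e(y) (x) g with [g] in one coset of the stabilizer reach every vector
of the block of [y], because [W] is irreducible. *)
Lemma ind_module_simple : prep_irr (stab x0) W -> simple_mod ind_module.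
Proof.
move=> Wirr; apply/simple_modP => v w v0.
have [x vx] : exists x, pr x *m v != 0.
  apply: contra_notP (negP v0) => /forallNP prv.
  rewrite -[v]mul1mx -sum_inj_pr mulmx_suml big1 // => x _.
  by have /negP := prv x; rewrite negbK => /eqP prx; rewrite -mulmxA prx mulmx0.
have xO : x \in orb x0.
  apply: contraR vx => xO; rewrite -[v]mul1mx -sum_inj_pr mulmx_suml mulmx_sumr.
  rewrite big1 // => y _; rewrite !mulmxA.
  have [<-|yx] := eqVneq x y; first by rewrite -(mulmxA (pr x)) inj0 // mul0mx mulmx0 mul0mx.
  by rewrite pr_inj0 // !mul0mx.
have /choice[a aP] y : exists a, mod_mx ind_module a *m v = inj y *m (pr y *m w).
  have [yO|yO] := boolP (y \in orb x0); last first.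
    by exists 0; rewrite inj0 // mul0mx /mod_mx raddf0 mul0mx.
  have [c cP] := Wirr _ (pr y *m w) vx.
  (* the elements carrying the block of x to the block of y *)
  pose k h := (s y * h * (s x)^-1)%g.
  exists (\sum_(h in stab x0) (c h / ind_coef y (k h)) *: tdb y (k h)).
  rewrite mod_mx_sum mulmx_suml -cP mulmx_sumr; apply: eq_bigr => h hst.
  have kE : gact (k h)^-1%g y = x.
    rewrite /k !invMg invgK !gactM -[X in gact (s y)^-1%g X](transporterP yO) gactK.
    by rewrite -[X in gact h^-1%g X](stabP _ _ hst) gactK transporterP.
  rewrite mod_mxZ ind_module_basis /ind_mx kE scalerA divfK ?ind_coef_neq0 //.
  have -> : ind_elt y (k h) = h by rewrite /ind_elt kE /k !mulgA mulVg mul1g mulgKV.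
  by rewrite -!scalemxAl -!scalemxAr !mulmxA.
exists (\sum_y a y); rewrite mod_mx_sum mulmx_suml -[w in RHS]mul1mx -sum_inj_pr.
by rewrite mulmx_suml; apply: eq_bigr => y _; rewrite aP mulmxA.
Qed.

End Induction.

Lemma ind_exists (x0 : X) (W : prep F G) :
    is_prep (stab x0) (stab_cocycle x0) W ->
  exists M : amodule D, [/\ corner x0 M W,
    forall x, mod_mx M (tdb x 1%g) != 0 -> x \in orb x0,
    mod_dim M = (#|orb x0| * (tag W).+1)%N
    & prep_irr (stab x0) W -> simple_mod M].
Proof.
move=> Wrep; have O0 : (0 < #|orb x0|)%N by apply/card_gt0P; exists x0; apply: orb_refl.
have [n nE [inj [pr [inj0 pr1 pr0 sum1]]]] := biproduct F (tag W) O0.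
exists (ind_module Wrep inj0 pr1 pr0 sum1); split=> //.
- exact: ind_module_corner.
- exact: ind_module_support.
exact: ind_module_simple.
Qed.

End Corner.

(** * Simple modules of the twisted double *)

Section CornerTheory.
Variables (F : fieldType) (G : finGroupType) (X : gset G) (alpha : cocycle F X).
Local Notation D := (twisted_double alpha).
Local Notation tdb := (td_basis alpha).
Local Notation e x := (tdb x 1%g).
Implicit Types (M : amodule D) (W : prep F G).

Lemma td_left_unit x g : e x * tdb x g = tdb x g.
Proof. by rewrite td_basisM cocycle1g gact1 eqxx mulr1 scale1r mul1g. Qed.

Lemma td_right_unit x g : g \in stab x -> tdb x g * e x = tdb x g.
Proof. by move/stabP=> gx; rewrite td_basisM cocycleg1 gx eqxx mulr1 scale1r mulg1. Qed.

Lemma td_idem x : e x * e x = e x.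
Proof. exact: td_left_unit. Qed.

Lemma td_stabM x g h : g \in stab x ->
  tdb x g * tdb x h = alpha g h x *: tdb x (g * h)%g.
Proof. by move/stabP=> gx; rewrite td_basisM gx eqxx mulr1. Qed.

(** The corner at [x] is the span of the e(x) (x) g with [g] in the stabilizer
of [x]. *)
Lemma td_corner x (a : D) :
  e x * a * e x = \sum_(g in stab x) a (x, g) *: tdb x g.
Proof.
rewrite [in LHS](td_sum a) mulr_sumr mulr_suml (bigD1 x) //= [X in _ + X]big1.
  rewrite addr0 mulr_sumr mulr_suml [RHS]big_mkcond /=; apply: eq_bigr => g _.
  rewrite -scalerAr -scalerAl td_left_unit td_basisM cocycleg1 mul1r mulg1.
  rewrite inE [x == _]eq_sym; case: eqP => _; first by rewrite scale1r.
  by rewrite scale0r scaler0.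
move=> y yx; rewrite mulr_sumr mulr_suml big1 // => g _.
rewrite -scalerAr -scalerAl td_basisM gact1 eq_sym (negPf yx) mulr0 scale0r.
by rewrite mul0r scaler0.
Qed.

Lemma corner_act x M W (C : 'M_((tag M).+1, (tag W).+1)) R a :
    C *m R = mod_mx M (e x) ->
    {in stab x, forall g, R *m mod_mx M (tdb x g) *m C = prep_mx W g} ->
  R *m mod_mx M (e x * a * e x) *m C = \sum_(g in stab x) a (x, g) *: prep_mx W g.
Proof.
move=> CR RC; rewrite td_corner mod_mx_sum mulmx_sumr mulmx_suml.
apply: eq_bigr => g gx; rewrite mod_mxZ -scalemxAr -scalemxAl RC //.
Qed.

(** A simple module is determined by any of its nonzero corners.  A vector
[v] of e(x) M and its image [v'] in e(x) M' have the same annihilator: if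
[a v = 0] then e(x) b a e(x) kills [v] for every [b], hence it kills [v'], and
[a v'] generates a submodule on which e(x) vanishes. *)
Lemma corner_mod_iso x M M' W W' :
    simple_mod M -> simple_mod M' -> corner x M W -> corner x M' W' ->
  piso (stab x) W W' -> mod_iso M M'.
Proof.
move=> simM simM' [C [R [RC CR cW]]] [C' [R' [RC' CR' cW']]] [B [B' [BB' B'B BP]]].
have [v v0] : exists v : 'cV[F]_((tag W).+1), v != 0.
  exists (const_mx 1); apply/eqP=> /colP/(_ 0)/eqP.
  by rewrite !mxE oner_eq0.
have Cv0 : C *m v != 0.
  by apply: contraNneq v0 => Cv; rewrite -[v]mul1mx -RC -mulmxA Cv mulmx0.
have Cv0' : C' *m (B *m v) != 0.
  apply: contraNneq v0 => Cv; rewrite -[v]mul1mx -B'B -mulmxA.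
  by rewrite -[B *m v]mul1mx -RC' -mulmxA Cv !mulmx0.
apply: (cyclic_iso simM simM' Cv0 Cv0') => a av.
(* the element e(x) b kills a v' for every b *)
have key b : mod_mx M' (e x * b) *m (mod_mx M' a *m (C' *m (B *m v))) = 0.
  have eC : C' = mod_mx M' (e x) *m C' by rewrite -CR' -mulmxA RC' mulmx1.
  have eC0 : C = mod_mx M (e x) *m C by rewrite -CR -mulmxA RC mulmx1.
  have -> : mod_mx M' (e x * b) *m (mod_mx M' a *m (C' *m (B *m v)))
     = C' *m (R' *m mod_mx M' (e x * (b * a) * e x) *m C') *m B *m v.
    have hZ z : C' *m (R' *m mod_mx M' (e x * z) *m C') = mod_mx M' (e x * z) *m C'.
      by rewrite -(mulmxA R') (mulmxA C') CR' mulmxA -mod_mxM mulrA td_idem.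
    rewrite -[e x * (b * a) * e x]mulrA hZ !mulrA (mod_mxM M' _ (e x)).
    by rewrite -(mulmxA _ _ C') -eC (mod_mxM M' _ a) !mulmxA.
  have := corner_act (b * a) CR' cW'; have := corner_act (b * a) CR cW.
  set w := \sum_(g in stab x) _; set w' := \sum_(g in stab x) _ => wE w'E.
  have Bw : B *m w = w' *m B.
    rewrite mulmx_sumr mulmx_suml; apply: eq_bigr => g gx.
    by rewrite -scalemxAr -scalemxAl BP.
  have wv : w *m v = 0.
    rewrite -wE -!mulmxA !mod_mxM -!mulmxA (mulmxA (mod_mx M (e x)) C) -eC0.
    by rewrite av !mulmx0.
  by rewrite w'E -(mulmxA C') -Bw -!mulmxA wv !mulmx0.
apply/eqP; apply: contraT => av'.
have [b bP] := (simple_modP M').1 simM' _ (C' *m (B *m v)) av'.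
have := key b; rewrite mod_mxM -mulmxA bP mulmxA -CR' -(mulmxA C') RC' mulmx1.
by move/eqP; rewrite (negPf Cv0').
Qed.

(** The intertwiner of the corners is the restriction of that of the modules. *)
Lemma corner_piso x M M' W W' :
  corner x M W -> corner x M' W' -> mod_iso M M' -> piso (stab x) W W'.
Proof.
move=> [C [R [RC CR cW]]] [C' [R' [RC' CR' cW']]] /mod_isoP[Q [Q' [QQ' Q'Q QP]]].
have QP' a : Q' *m mod_mx M' a = mod_mx M a *m Q'.
  by rewrite -[LHS]mulmx1 -QQ' mulmxA -(mulmxA Q') -QP mulmxA Q'Q mul1mx.
exists (R' *m Q *m C), (R *m Q' *m C'); split=> [||g gx].
- rewrite !mulmxA -(mulmxA _ C R) CR -(mulmxA R' Q) QP.
  rewrite -CR' !mulmxA RC' mul1mx -(mulmxA _ Q Q') QQ' mulmx1.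
  exact: RC'.
- rewrite !mulmxA -(mulmxA _ C' R') CR' -(mulmxA R Q') QP'.
  by rewrite -CR !mulmxA RC mul1mx -(mulmxA _ Q' Q) Q'Q mulmx1.
transitivity (R' *m mod_mx M' (tdb x g) *m Q *m C).
  rewrite -cW // !mulmxA -(mulmxA _ C R) CR -(mulmxA (R' *m Q)) -mod_mxM.
  by rewrite td_left_unit -(mulmxA R' Q) QP !mulmxA.
rewrite -cW' // !mulmxA -(mulmxA _ C' R') CR' -(mulmxA R' _ (mod_mx M' _)).
by rewrite -mod_mxM td_right_unit.
Qed.

Lemma idempotent_split (n : nat) (E : 'M[F]_n.+1) : E *m E = E -> E != 0 ->
  exists d : nat, exists C : 'M[F]_(n.+1, d.+1), exists R : 'M[F]_(d.+1, n.+1),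
    R *m C = 1%:M /\ C *m R = E.
Proof.
move=> EE E0; have rE : (0 < \rank E)%N by rewrite lt0n mxrank_eq0.
have : row_base E *m col_base E = 1%:M.
  have := mulmx_base E; have := row_base_free E; have /row_fullP[L] := col_base_full E.
  move: (col_base E) (row_base E) => C R LC Rfree CR.
  apply: (row_free_inj Rfree); rewrite mul1mx.
  rewrite -[LHS]mul1mx -[RHS]mul1mx -LC -!mulmxA; congr (L *m _).
  by rewrite CR mulmxA CR EE.
have := mulmx_base E.
move: (col_base E) (row_base E); case: (\rank E) rE => // d _ C R CR RC.
by exists d, C, R.
Qed.

(** The corner of a simple module is simple: if [a] carries [v] to [w], both
in e(x) M, then so does e(x) a e(x). *)
Lemma corner_exists x M : simple_mod M -> mod_mx M (e x) != 0 ->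
  exists W, [/\ corner x M W, is_prep (stab x) (stab_cocycle alpha x) W
              & prep_irr (stab x) W].
Proof.
move=> simM E0.
have [||d [C [R [RC CR]]]] := @idempotent_split _ (mod_mx M (e x)) => //.
  by rewrite -mod_mxM td_idem.
pose W : prep F G := existT _ d (fun g => R *m mod_mx M (tdb x g) *m C).
have cW : {in stab x, forall g, R *m mod_mx M (tdb x g) *m C = prep_mx W g} by [].
exists W; split; first by exists C, R.
  split=> [|g h gx hx]; first by rewrite /prep_mx /= -CR !mulmxA RC mul1mx RC.
  rewrite /prep_mx /= !mulmxA -(mulmxA _ C R) CR -(mulmxA R (mod_mx M _)) -mod_mxM.
  rewrite td_right_unit // -(mulmxA R (mod_mx M _)) -mod_mxM td_stabM //.
  by rewrite mod_mxZ -scalemxAr -scalemxAl.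
move=> v w v0; have Cv0 : C *m v != 0.
  by apply: contraNneq v0 => Cv; rewrite -[v]mul1mx -RC -mulmxA Cv mulmx0.
have [a aP] := (simple_modP M).1 simM _ (C *m w) Cv0.
exists (fun g => a (x, g)).
have := @corner_act x M W C R a CR cW; rewrite !mod_mxM -CR => cE.
transitivity ((\sum_(g in stab x) a (x, g) *: prep_mx W g) *m v).
  by rewrite mulmx_suml; apply: eq_bigr => g _; rewrite scalemxAl.
rewrite -cE !mulmxA RC mul1mx -(mulmxA _ R C) RC mulmx1 -!mulmxA aP.
by rewrite mulmxA RC mul1mx.
Qed.

Lemma support_exists M : exists x, mod_mx M (e x) != 0.
Proof.
apply: contrapT => /forallNP h; have : mod_mx M 1 = 0.
  rewrite -[1]/(td_one alpha) /td_one mod_mx_sum big1 // => x _.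
  by apply/eqP/negPn/negP/h.
by rewrite mod_mx1 => /eqP; rewrite oner_eq0.
Qed.

(** The idempotents of two points of one orbit are conjugate up to a scalar. *)
Lemma support_orb M x y : y \in orb x ->
  mod_mx M (e x) != 0 -> mod_mx M (e y) != 0.
Proof.
case/orbP=> g gx; apply: contraNneq => ey.
have : mod_mx M (tdb x g^-1%g * tdb y g) = 0.
  by rewrite -(td_left_unit y g) !mod_mxM ey mul0mx mulmx0.
rewrite td_basisM -gx gactK eqxx mulr1 mulVg mod_mxZ => /eqP.
by rewrite scaler_eq0 (negPf (cocycle_unit _ _ _ _)).
Qed.

Lemma support_iso M M' x : mod_iso M M' ->
  mod_mx M (e x) != 0 -> mod_mx M' (e x) != 0.
Proof.
case/mod_isoP=> Q [Q' [QQ' Q'Q QP]]; apply: contraNneq => ex.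
by rewrite -[mod_mx M _]mul1mx -Q'Q -mulmxA QP ex mul0mx mulmx0.
Qed.

Lemma corner_support M W x : corner x M W -> mod_mx M (e x) != 0.
Proof.
case=> C [R [RC CR _]]; rewrite -CR; apply/eqP=> CR0.
have : R *m C *m (R *m C) = 0 by rewrite !mulmxA -(mulmxA R C R) CR0 mulmx0 mul0mx.
by rewrite RC mulmx1 => /eqP; rewrite oner_eq0.
Qed.

(** Every simple module of dimension prime to p is supported on one orbit, of
length prime to p, and is induced from the stabilizer of the point of [Y] in
that orbit. *)
Theorem td_transversal (p : nat) (Y : {set X}) (n : X -> nat)
    (s : forall y, 'I_(n y) -> prep F G) :
    (forall x, coprime #|orb x| p -> exists2 y, y \in Y & y \in orb x) ->
    (forall y y', y \in Y -> y' \in Y -> y' \in orb y -> y = y') ->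
    (forall y, y \in Y -> coprime #|orb y| p) ->
    (forall y, y \in Y ->
       transversal (pirr p (stab y) (stab_cocycle alpha y)) (piso (stab y)) (s y)) ->
  exists t : {y : {y | y \in Y} & 'I_(n (val y))} -> amodule D,
    transversal (coprime_simple p) (@mod_iso F D) t.
Proof.
move=> Yex Yuniq Ycop sP.
have /choice[t tP] : forall u : {y : {y | y \in Y} & 'I_(n (val y))},
    exists M : amodule D, [/\ corner (val (tag u)) M (s _ (tagged u)),
    forall x, mod_mx M (e x) != 0 -> x \in orb (val (tag u)),
    mod_dim M = (#|orb (val (tag u))| * (tag (s _ (tagged u))).+1)%N
    & simple_mod M].
  move=> [[y Yy] i] /=; have [/(_ i)[Wrep Wirr _] _ _] := sP y Yy.
  have [M [? ? ? simM]] := ind_exists Wrep.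
  by exists M; split=> //; apply: simM.
exists t; split=> [u|u u' tuu'|M [simM copM]].
- have [_ _ dimE simE] := tP u; split=> //; rewrite dimE coprimeMl.
  case: u {dimE simE} => [[y Yy] i] /=; rewrite Ycop //=.
  by have [/(_ i)[]] := sP y Yy.
- have [cu supu _ _] := tP u; have [cu' supu' _ _] := tP u'.
  have yy : val (tag u) = val (tag u').
    apply/esym/Yuniq; try exact: (valP (tag _)).
    exact/supu'/(support_iso tuu')/corner_support/cu.
  move: u u' yy cu cu' tuu' {supu supu'} => [[y Yy] i] [[y' Yy'] i'] /= yy.
  subst y'; rewrite (bool_irrelevance Yy' Yy) => cu cu' tuu'.
  have [_ s_inj _] := sP y Yy.
  by rewrite (s_inj i i') //; apply: corner_piso cu cu' tuu'.
have [x ex] := support_exists M.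
have dimM : exists d, mod_dim M = (#|orb x| * d)%N.
  have [W [cW Wrep Wirr]] := corner_exists simM ex.
  have [M' [cM' _ dimM' simM']] := ind_exists Wrep.
  exists (tag W).+1; rewrite -dimM'; apply: mod_iso_dim.
  exact: (corner_mod_iso simM (simM' Wirr) cW cM' (piso_refl _ _)).
have [y Yy yx] : exists2 y, y \in Y & y \in orb x.
  by apply: Yex; have [d dE] := dimM; move: copM; rewrite dE coprimeMl => /andP[].
have ey := support_orb yx ex.
have [W [cW Wrep Wirr]] := corner_exists simM ey.
have [M' [cM' _ dimM' /(_ Wirr) simM']] := ind_exists Wrep.
have MM' := corner_mod_iso simM simM' cW cM' (piso_refl _ _).
have Wp : pirr p (stab y) (stab_cocycle alpha y) W.
  split=> //; move: copM; rewrite (mod_iso_dim MM') dimM' coprimeMl.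
  by case/andP.
have [_ _ /(_ W Wp)[i iW]] := sP y Yy.
exists (existT _ (exist _ y Yy) i).
have [cu _ _ simu] := tP (existT _ (exist _ y Yy) i).
exact: corner_mod_iso simu simM cu cW iW.
Qed.

End CornerTheory.

(** * Rational polynomials and roots of unity *)

Section Interpolation.
Variable K : fieldType.

Lemma interpolation (T : eqType) (s : seq T) (x w : T -> K) :
  {in s &, injective x} -> exists f : {poly K}, {in s, forall t, f.[x t] = w t}.
Proof.
elim: s => [|a s IHs] x_inj; first by exists 0.
have [|f fP] := IHs; first by apply: sub_in2 x_inj => t ts; rewrite inE ts orbT.
have [as_|as_] := boolP (a \in s).
  by exists f => t; rewrite inE => /predU1P[->|]; apply: fP.
pose h : {poly K} := \prod_(t <- s) ('X - (x t)%:P).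
have hE t : h.[t] = \prod_(u <- s) (t - x u).
  by rewrite horner_prod; apply: eq_bigr => u _; rewrite hornerXsubC.
have ha : h.[x a] != 0.
  rewrite hE prodf_seq_neq0; apply/allP=> u us /=; rewrite subr_eq0.
  apply: contraNneq as_ => xau; rewrite (_ : a = u) //.
  by apply: x_inj; rewrite ?mem_head // inE us orbT.
exists (f + ((w a - f.[x a]) / h.[x a]) *: h) => t.
rewrite inE hornerD hornerZ => /predU1P[->|ts].
  by rewrite divfK // addrC subrK.
have -> : h.[x t] = 0.
  by rewrite hE; apply/eqP; rewrite prodf_seq_eq0; apply/hasP; exists t; rewrite //= subrr.
by rewrite mulr0 addr0 fP.
Qed.

End Interpolation.

Section CyclotomicConjugates.
Variable F : numClosedFieldType.

Local Notation ZtoF := (intr : int -> F).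
Local Notation QtoF := (@ratr F).

(** Comparing the factorization of X^m - 1 into cyclotomic polynomials with
those of X^d - 1 for the proper divisors d of m leaves only the m-th factor. *)
Lemma root_Cyclotomic_prim (m : nat) (z : F) :
  m.-primitive_root z -> root (map_poly ZtoF 'Phi_m) z.
Proof.
move=> prim_z; have m_gt0 := prim_order_gt0 prim_z.
have: root (map_poly ZtoF ('X^m - 1)) z.
  by rewrite rmorphB /= map_polyXn rmorph1 /root !hornerE prim_expr_order ?subrr.
rewrite -prod_Cyclotomic // rmorph_prod /= /root horner_prod.
rewrite prodf_seq_eq0 => /hasP[d]; rewrite -dvdn_divisors //= => dm zd.
have [->//|dm'] := eqVneq m d; have d_gt0 := dvdn_gt0 m_gt0 dm.
have: root (map_poly ZtoF ('X^d - 1)) z.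
  rewrite -prod_Cyclotomic // rmorph_prod /= /root horner_prod.
  by rewrite prodf_seq_eq0; apply/hasP; exists d; rewrite // -dvdn_divisors.
rewrite rmorphB /= map_polyXn rmorph1 /root !hornerE subr_eq0.
by rewrite -(prim_order_dvd prim_z) => md; rewrite eqn_dvd md dm in dm'.
Qed.

(** The cyclotomic polynomial is irreducible over Q, a fact known from minimal
polynomials of algebraic numbers.  Irreducibility is a statement about
rational polynomials, so Bezout coefficients carry it over to [F]. *)
Lemma rat_root_prim_conj (m : nat) (z z' : F) (g : {poly rat}) :
  m.-primitive_root z -> m.-primitive_root z' ->
  root (map_poly QtoF g) z -> root (map_poly QtoF g) z'.
Proof.
move=> prim_z prim_z' gz; have m_gt0 := prim_order_gt0 prim_z.
pose p : {poly rat} := map_poly intr 'Phi_m.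
have p_ratr (K : numFieldType) : map_poly ratr p = map_poly intr 'Phi_m :> {poly K}.
  by rewrite -map_poly_comp; apply: eq_map_poly => x; rewrite /= ratr_int.
have [pg|npg] := boolP (p %| g)%R.
  have [h ->] := dvdpP _ _ pg.
  by rewrite rmorphM rootM /= p_ratr root_Cyclotomic_prim ?orbT.
suffices cop : coprimep p g.
  have [[u v] /= uv] := Bezout_eq1_coprimepP _ _ cop.
  have /(congr1 (fun q => (map_poly QtoF q).[z])) := uv.
  rewrite rmorphD !rmorphM rmorph1 /= !hornerE (rootP gz) p_ratr.
  by rewrite (rootP (root_Cyclotomic_prim prim_z)) !mulr0 addr0 => /esym/eqP; rewrite oner_eq0.
apply: contraNT npg; rewrite coprimep_def => szr.
set r := gcdp p g in szr; have : size (map_poly (ratr : rat -> algC) r) != 1%N.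
  by rewrite size_map_poly.
case/closed_rootP=> x rx.
have root_r q : r %| q -> root (map_poly (ratr : rat -> algC) q) x.
  by case/dvdpP=> h ->; rewrite rmorphM rootM /= rx orbT.
have px : root (map_poly (ratr : rat -> algC) p) x.
  exact/root_r/dvdp_gcdl.
have prim_x : m.-primitive_root x.
  have [y prim_y] := C_prim_root_exists m_gt0.
  by rewrite -(root_cyclotomic prim_y) -(Cintr_Cyclotomic prim_y) -p_ratr.
have [q [qE q_mon] qP] := minCpolyP x.
have pq : p = q.
  apply: (map_poly_inj (ratr : {rmorphism rat -> algC})).
  by rewrite -qE p_ratr (Cintr_Cyclotomic prim_x) (minCpoly_cyclotomic prim_x).
by rewrite pq -qP; apply/root_r/dvdp_gcdr.
Qed.

End CyclotomicConjugates.

(** * Counting irreducible representations over a central character *)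

Lemma mxtrace_delta (K : pzRingType) n (i j : 'I_n) :
  \tr (delta_mx i j : 'M[K]_n) = (i == j)%:R.
Proof.
rewrite /mxtrace (bigD1 i) //= big1 => [|k ki]; rewrite mxE.
  by rewrite eqxx addr0.
by rewrite (negPf ki).
Qed.

Lemma prim_rootV (K : fieldType) m (z : K) :
  m.-primitive_root z -> m.-primitive_root z^-1.
Proof.
move=> prim_z; have m0 := prim_order_gt0 prim_z.
have -> : z^-1 = z ^+ m.-1.
  have z0 : z != 0 by rewrite (prim_root_eq0 prim_z) -lt0n.
  by apply: (mulfI z0); rewrite mulfV // -exprS prednK // prim_expr_order.
by rewrite prim_root_exp_coprime // coprime_sym coprimenP.
Qed.

Section GaloisCount.
Variables (F : numClosedFieldType) (gT : finGroupType) (L : {group gT}).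

Section AbsIrr.
Variables (n : nat) (rG : mx_representation F L n).
Hypothesis irrG : mx_absolutely_irreducible rG.

Lemma irr_scalar (A : 'M[F]_n) :
  (forall x, x \in L -> A *m rG x = rG x *m A) ->
  A = (\tr A / n%:R)%:M.
Proof.
move=> cA; have d0 : n%:R != 0 :> F.
  by case/andP: irrG => n0 _; rewrite pnatr_eq0 -lt0n.
have /is_scalar_mxP[a ->] : is_scalar_mx A.
  apply: (mx_abs_irr_cent_scalar irrG).
  exact/centgmxP.
by rewrite mxtrace_scalar -[a *+ _]mulr_natr mulfK.
Qed.

(** The average of the conjugates of a matrix is central, hence scalar by
Schur's lemma, and the trace identifies the scalar. *)
Lemma sum_conj_irr (A : 'M[F]_n) :
  \sum_(x in L) rG x^-1%g *m A *m rG x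
  = (#|L|%:R * \tr A / n%:R)%:M.
Proof.
rewrite [LHS]irr_scalar => [|y Ly].
  congr (_ / _)%:M; rewrite raddf_sum /= mulr_natl -sumr_const.
  apply: eq_bigr => x Lx; rewrite mxtrace_mulC mulmxA -repr_mxM ?groupV //.
  by rewrite mulgV repr_mx1 mul1mx.
rewrite mulmx_suml mulmx_sumr (reindex_inj (mulIg y^-1%g)) /=.
apply: eq_big => [x|x Lx]; first by rewrite groupMr ?groupV.
have Lx' : x \in L by rewrite -(mulgKV y x) groupM.
rewrite invMg invgK !repr_mxM ?groupV // -!mulmxA.
rewrite -(repr_mxM _ (groupVr Ly) Ly).
by rewrite mulVg repr_mx1 mulmx1.
Qed.

(** Summing over [y] first gives a multiple of the inverse of [x] by
[sum_conj_irr]; the remaining sum is evaluated on matrix units by the same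
lemma. *)
Lemma sum_commg_irr :
  \sum_(x in L) \sum_(y in L) rG [~ x, y]%g
  = ((#|L|%:R / n%:R) ^+ 2)%:M.
Proof.
have inner x : x \in L -> \sum_(y in L) rG [~ x, y]%g
    = (#|L|%:R / n%:R * \tr (rG x)) *: rG x^-1%g.
  move=> Lx; transitivity (rG x^-1%g *m
     \sum_(y in L) (rG y^-1%g *m rG x *m rG y)).
    rewrite mulmx_sumr; apply: eq_bigr => y Ly.
    by rewrite -!repr_mxM ?groupM ?groupV // commgEl /conjg !mulgA.
  by rewrite sum_conj_irr -mul_mx_scalar mulrAC.
rewrite (eq_bigr _ inner) expr2 -[_ * _ in RHS]mulr1 -scale_scalar_mx -scalerA.
under eq_bigr do rewrite -scalerA.
rewrite -scaler_sumr; congr (_ *: _).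
apply/matrixP=> a b; rewrite summxE !mxE.
transitivity (\sum_(x in L) \sum_c rG x^-1%g a b * rG x c c).
  by apply: eq_bigr => x _; rewrite !mxE mulrC mulr_sumr.
rewrite exchange_big /=.
transitivity (\sum_c (\sum_(x in L)
    rG x^-1%g *m delta_mx b c *m rG x) a c).
  apply: eq_bigr => c _; rewrite summxE; apply: eq_bigr => x _.
  rewrite -(mul_delta_mx (0 : 'I_1)) mulmxA -mulmxA -colE -rowE.
  by rewrite !mxE big_ord1 !mxE.
rewrite (bigD1 b) //= [X in _ + X]big1 => [|c cb]; rewrite sum_conj_irr mxE mxtrace_delta.
  by rewrite eqxx mulr1 addr0 mulr_natr.
by rewrite eq_sym (negPf cb) mulr0 mul0r mul0rn.
Qed.

End AbsIrr.

Definition irrs : irrType F L := DecSocleType (regular_repr F L).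

Local Notation rho i := (@irr_repr _ _ _ irrs i).
Local Notation deg i := (@irr_degree _ _ _ irrs i).
Local Notation mode := (@irr_mode _ _ _ irrs).

Lemma charF_pi' : ([pchar F]^'.-group L)%g.
Proof. by apply/pgroupP=> q _ _; rewrite inE /= pchar_num. Qed.

Lemma closed_group_splitting : group_splitting_field F L.
Proof. exact: group_closure_closed_field. Qed.

(** The element of the rational group ring that is [f] evaluated at the sum of
all commutators. *)
Lemma group_ring_poly (f : {poly rat}) : exists a : gT -> rat,
  forall n (rG : mx_representation F L n) (c : F),
  \sum_(x in L) \sum_(y in L) rG [~ x, y]%g = c%:M ->
  \sum_(g in L) ratr (a g) *: rG g = (map_poly ratr f).[c]%:M.
Proof.
elim/poly_ind: f => [|f q [a aP]].
  exists (fun=> 0) => n rG c _; rewrite map_poly0 horner0 -scalemx1 scale0r big1 // => g _.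
  by rewrite rmorph0 scale0r.
exists (fun g => \sum_(h in L) \sum_(x in L) \sum_(y in L)
   a h *+ (h * [~ x, y] == g)%g + q *+ (g == 1%g)) => n rG c cP.
rewrite rmorphD rmorphM /= map_polyX map_polyC hornerMXaddC raddfD /= scalar_mxM.
rewrite -(aP _ _ _ cP) -cP.
under eq_bigr do rewrite rmorphD scalerDl.
rewrite big_split /=; congr (_ + _); last first.
  rewrite (bigD1 1%g) //= big1 => [|g /andP[_ /negPf->]].
    by rewrite eqxx addr0 repr_mx1 scalemx1.
  by rewrite rmorph0 scale0r.
rewrite mulmx_suml.
transitivity (\sum_(g in L) \sum_(h in L) \sum_(x in L) \sum_(y in L)
   (ratr (a h) *+ (h * [~ x, y] == g)%g) *: rG g).
  apply: eq_bigr => g Lg; rewrite rmorph_sum scaler_suml; apply: eq_bigr => h _.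
  rewrite rmorph_sum scaler_suml; apply: eq_bigr => x _.
  by rewrite rmorph_sum scaler_suml; apply: eq_bigr => y _; rewrite rmorphMn.
rewrite exchange_big; apply: eq_bigr => h Lh.
rewrite mulmx_sumr exchange_big; apply: eq_bigr => x Lx.
rewrite mulmx_sumr exchange_big; apply: eq_bigr => y Ly.
have Lc : [~ x, y]%g \in L by rewrite groupR.
rewrite (bigD1 (h * [~ x, y])%g) /=; last by rewrite groupM.
rewrite [X in _ + X]big1 => [|g /andP[_ /negPf gn]].
  by rewrite eqxx addr0 -scalemxAl repr_mxM.
by rewrite eq_sym gn scale0r.
Qed.

Lemma abs_irr i : mx_absolutely_irreducible (rho i).
Proof. exact/closed_group_splitting/socle_irr. Qed.

Lemma irr_degree_le i : (deg i <= #|L|)%N.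
Proof. exact: rank_leq_row. Qed.

(** An element of the rational group ring acts on the irreducible
representation of degree d as 1 / d^2 if d is prime to p and as 0 otherwise,
by interpolation at the scalars of [sum_commg_irr].  The irreducible
representation of degree d occurs d times in the regular representation, so
the trace there of this element times [z] is the sum on the left; it is
rational because the regular representation is. *)
Lemma rational_mode_sum p (z : gT) : z \in 'Z(L)%g ->
  exists q : rat, \sum_(i : irrs | coprime (deg i) p) mode i z = ratr q.
Proof.
move=> Zz; have Lz : z \in L by case/setIP: Zz.
have [f fP] : exists f : {poly rat}, {in iota 1 #|L|, forall d,
    f.[(#|L|%:R / d%:R) ^+ 2] = (coprime d p)%:R / d%:R ^+ 2}.
  apply: interpolation => d e; rewrite !mem_iota => /andP[d0 _] /andP[e0 _].
  move/eqP; rewrite eqrXn2 ?divr_ge0 ?ler0n // => /eqP.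
  have LL : #|L|%:R != 0 :> rat by rewrite pnatr_eq0 -lt0n cardG_gt0.
  by move/(mulfI LL)/invr_inj/eqP; rewrite eqr_nat => /eqP.
have [a aP] := group_ring_poly f.
(* the trace computed in the regular representation over the rationals *)
pose q := \sum_(g in L) a g * \tr (regular_repr rat L (g * z)%g).
exists q; rewrite rmorph_sum /=.
transitivity (\sum_(g in L) \sum_(i : irrs)
   (ratr (a g) * \tr (rho i (g * z)%g)) *+ deg i); last first.
  apply: eq_bigr => g Lg; rewrite rmorphM /=; under eq_bigr do rewrite -mulrnAr.
  rewrite -mulr_sumr -(mxtrace_regular_pchar irrs charF_pi' closed_group_splitting) ?groupM //.
  by congr (_ * _); rewrite -(map_regular_repr (@ratr F)) map_reprE trace_map_mx.
rewrite exchange_big [LHS]big_mkcond /=; apply: eq_bigr => i _.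
transitivity (\tr ((\sum_(g in L) ratr (a g) *: rho i g) *m rho i z) *+ deg i); last first.
  rewrite mulmx_suml raddf_sum /= -sumrMnl; apply: eq_bigr => g Lg.
  by rewrite -scalemxAl mxtraceZ repr_mxM.
have d0 : (deg i)%:R != 0 :> F by rewrite pnatr_eq0 -lt0n irr_degree_gt0.
rewrite (aP _ _ _ (sum_commg_irr (abs_irr i))) (irr_center_scalar closed_group_splitting) //.
rewrite -scalar_mxM mxtrace_scalar.
have -> : (#|L|%:R / (deg i)%:R) ^+ 2 = ratr ((#|L|%:R / (deg i)%:R) ^+ 2) :> F.
  by rewrite rmorphXn fmorph_div !rmorph_nat.
rewrite horner_map /= fP; last first.
  by rewrite mem_iota irr_degree_gt0 add1n ltnS irr_degree_le.
rewrite fmorph_div rmorphXn !rmorph_nat -mulrnA -[RHS]mulr_natr natrM.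
case: coprime; last by rewrite !mul0r.
by rewrite mul1r [_ * mode i z]mulrC -mulrA -expr2 mulVf ?mulr1 ?expf_neq0.
Qed.

(** The number of irreducible representations of degree prime to [p] on which
the central element [z] acts as [c]. *)
Definition mode_count p (z : gT) (c : F) : nat :=
  #|[pred i : irrs | coprime (deg i) p && (mode i z == c)]|.

Lemma mode_expn m z i : z \in 'Z(L)%g -> (z ^+ m = 1)%g -> mode i z ^+ m = 1.
Proof. by move=> Zz zm; rewrite -(irr_modeX closed_group_splitting) // zm irr_mode1. Qed.

Lemma sum_mode_count p m z (zeta : F) : z \in 'Z(L)%g -> (z ^+ m = 1)%g ->
  m.-primitive_root zeta ->
  \sum_(j < m) mode_count p z (zeta ^+ j) = #|[pred i : irrs | coprime (deg i) p]|.
Proof.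
move=> Zz zm prim_z; have m0 := prim_order_gt0 prim_z.
rewrite -sum1_card; transitivity (\sum_(j < m)
    \sum_(i : irrs | coprime (deg i) p && (mode i z == zeta ^+ j)) 1)%N.
  by apply: eq_bigr => j _; rewrite sum1_card.
rewrite (exchange_big_dep [pred i : irrs | coprime (deg i) p]) /=; last first.
  by move=> j i _; case/andP.
apply: eq_bigr => i pi.
have [j jE] := prim_rootP prim_z (mode_expn i Zz zm).
rewrite (bigD1 j) /=; last by rewrite jE eqxx andbT; exact: pi.
rewrite big1 // => k /andP[/andP[_ /eqP kE] kj].
case/eqP: kj; apply: val_inj; apply/eqP; rewrite /= -(modn_small (ltn_ord k)).
by rewrite -(modn_small (ltn_ord j)) -(eq_prim_root_expr prim_z) -kE -jE.
Qed.

(** Fourier inversion on the group generated by [z] expresses [m] times the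
count at [c] as the value at [c^-1] of a rational polynomial independent of
[c]. *)
Lemma mode_count_conj p m z (zeta : F) j : z \in 'Z(L)%g -> (z ^+ m = 1)%g ->
  m.-primitive_root zeta -> coprime j m ->
  mode_count p z (zeta ^+ j) = mode_count p z zeta.
Proof.
move=> Zz zm prim_z co_jm; have m0 := prim_order_gt0 prim_z.
have /choice[q qP] : forall k, exists q : rat,
    \sum_(i : irrs | coprime (deg i) p) mode i z ^+ k = ratr q.
  move=> k; have [|q qE] := @rational_mode_sum p (z ^+ k)%g; first by rewrite groupX.
  by exists q; rewrite -qE; apply: eq_bigr => i _; rewrite (irr_modeX closed_group_splitting).
have fourier c : m.-primitive_root c ->
    (m * mode_count p z c)%:R = (map_poly ratr (\poly_(k < m) q k)).[c^-1] :> F.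
  move=> prim_c; have c0 : c != 0 by rewrite (prim_root_eq0 prim_c) -lt0n.
  have -> : map_poly ratr (\poly_(k < m) q k) = \poly_(k < m) ratr (q k) :> {poly F}.
    by apply/polyP=> k; rewrite coef_map /= !coef_poly; case: ltnP => _ //; rewrite raddf0.
  rewrite horner_poly natrM.
  transitivity (\sum_(i : irrs | coprime (deg i) p) \sum_(k < m) (mode i z / c) ^+ k).
    rewrite /mode_count -sum1_card natr_sum mulr_sumr big_mkcondr /=.
    apply: eq_bigr => i _; have [->|modec] := eqVneq.
      rewrite mulr1 -[m in m%:R]card_ord -sumr_const; apply: eq_bigr => k _.
      by rewrite divff // expr1n.
    have := subrX1 (mode i z / c) m.
    rewrite expr_div_n (prim_expr_order prim_c) (mode_expn i Zz zm) divr1 subrr.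
    move/esym/eqP; rewrite mulf_eq0 subr_eq0 => /orP[/eqP mc|/eqP-> //].
    by case/eqP: modec; rewrite -[LHS](divfK c0) mc mul1r.
  rewrite exchange_big /=; apply: eq_bigr => k _.
  rewrite -qP mulr_suml; apply: eq_bigr => i _.
  by rewrite expr_div_n exprVn.
have prim_j : m.-primitive_root (zeta ^+ j) by rewrite prim_root_exp_coprime.
have : root (map_poly ratr (\poly_(k < m) q k - (m * mode_count p z zeta)%:R%:P))
     (zeta ^+ j)^-1.
  apply: (@rat_root_prim_conj _ m zeta^-1).
  - exact: prim_rootV.
  - exact: prim_rootV.
  by rewrite rmorphB /= map_polyC /= ratr_nat /root !hornerE -fourier ?subrr.
rewrite rmorphB /= map_polyC /= ratr_nat /root !hornerE -fourier // subr_eq0.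
by rewrite eqr_nat eqn_pmul2l // => /eqP.
Qed.

End GaloisCount.

(** * Irreducible representations as projective representations *)

Section OrdinaryReps.
Variables (F : numClosedFieldType) (gT : finGroupType) (L : {group gT}).

Local Notation one_cocycle := (fun _ _ : gT => 1 : F).

Lemma prep_reprP (W : prep F gT) :
  is_prep L one_cocycle W <-> mx_repr L (prep_mx W).
Proof.
split=> -[W1 WM]; split=> // g h Lg Lh; first by rewrite WM ?scale1r.
by rewrite scale1r WM.
Qed.

Lemma rsim_piso (W W' : prep F gT) (rW : mx_repr L (prep_mx W))
    (rW' : mx_repr L (prep_mx W')) :
  mx_rsim (MxRepresentation rW) (MxRepresentation rW') <-> piso L W W'.
Proof.
split=> [/mx_rsim_def[B [B' B'B BP]]|[B [B' [BB' B'B BP]]]].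
  exists B', B; split=> // [|g Lg].
    by have := BP 1%g (group1 L); rewrite !repr_mx1 mulmx1.
  by have /= -> := BP g Lg; rewrite !mulmxA B'B mul1mx.
apply: (@MxReprSim _ _ _ _ _ _ _ B').
- exact: eq_dim_of_inv B'B BB'.
- by apply/row_freeP; exists B.
move=> g Lg /=; rewrite -[LHS]mul1mx -B'B !mulmxA -(mulmxA B' B) BP //.
by rewrite -!mulmxA BB' mulmx1.
Qed.

(** Projective families act on columns whereas [mx_irreducible] concerns
subspaces of rows.  A stable row space that is not full kills a nonzero column,
hence all columns; conversely the matrices of an irreducible representation
span the full matrix algebra. *)
Lemma prep_irrP (W : prep F gT) (rW : mx_repr L (prep_mx W)) :
  prep_irr L W <-> mx_irreducible (MxRepresentation rW).
Proof.
split=> [Wirr|irrW].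
  apply/mx_irrP; split=> // U modU; apply: contraR.
  rewrite -sub1mx submxE mul1mx => /eqP/matrixP; have := mulmx_coker U.
  move: (cokermx U) => C UC ker.
  have [j kj] : exists j, col j C != 0.
    apply: contra_notP ker => /forallNP h i j.
    have /negP/negPn/eqP/colP/(_ i) := h j.
    by rewrite !mxE.
  apply/eqP/row_matrixP=> i; rewrite row0; apply/rowP=> k.
  have [c cP] := Wirr _ (delta_mx k 0) kj.
  have : U *m delta_mx k 0 = 0 :> 'cV_(_).
    rewrite -cP mulmx_sumr big1 // => g Lg.
    have /submxP[D DE] : (U *m prep_mx W g <= U)%MS := mxmoduleP modU g Lg.
    rewrite -scalemxAl -scalemxAr mulmxA DE colE -!mulmxA (mulmxA U).
    by rewrite UC mul0mx !mulmx0 scaler0.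
  by rewrite -colE => /colP/(_ i); rewrite !mxE.
have /mx_abs_irrP[_ [a aP]] := @closed_group_splitting F gT L _ _ irrW.
move=> v w v0; have [k vk] : exists k, v k 0 != 0.
  apply: contra_notP (negP v0) => /forallNP h; apply/eqP/colP=> k.
  by have /negP/negPn/eqP-> := h k; rewrite mxE.
exists (fun g => a g (w *m ((v k 0)^-1 *: delta_mx 0 k))).
rewrite -mulmx_suml -aP -scalemxAr -scalemxAl -mulmxA -rowE.
have -> : row k v = (v k 0)%:M by apply/rowP=> j; rewrite !mxE ord1 eqxx.
by rewrite mul_mx_scalar scalerA mulVf // scale1r.
Qed.

Lemma irr_prep_exists (i : irrs F L) :
  exists W : prep F gT, exists rW : mx_repr L (prep_mx W),
    mx_rsim (irr_repr i) (MxRepresentation rW).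
Proof.
have := irr_degree_gt0 i; move: (irr_repr i).
case: (irr_degree i) => // n [r rP] _.
by exists (existT _ n r), rP; apply: mx_rsim_refl.
Qed.

(** With [z = 1] and [c = 1] this enumerates the irreducible representations
of degree prime to [p]; a central [z] singles out those over one central
character. *)
Lemma irr_transversal p (z : gT) (c : F) : z \in 'Z(L)%g ->
  exists s : {i : irrs F L | coprime (irr_degree i) p && (irr_mode i z == c)} -> prep F gT,
    transversal (fun W => pirr p L one_cocycle W /\ prep_mx W z = c%:M) (piso L) s.
Proof.
move=> Zz; have Lz : z \in L by case/setIP: Zz.
pose I := {i : irrs F L | coprime (irr_degree i) p && (irr_mode i z == c)}.
have /choice[s sP] : forall i : I, exists W : prep F gT,
    exists rW : mx_repr L (prep_mx W), mx_rsim (irr_repr (val i)) (MxRepresentation rW).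
  by move=> i; apply: irr_prep_exists.
exists s; split=> [i|i j ij|W [Wp Wz]].
- have [rW sim] := sP i; case/andP: (valP i) => cop /eqP modeE.
  split; last first.
    have := mx_rsim_scalar Lz sim (irr_center_scalar (@closed_group_splitting F gT L) _ Zz).
    by rewrite modeE.
  split; first exact/prep_reprP.
    by apply/prep_irrP; apply: mx_rsim_irr sim (socle_irr _).
  by have := mxrank_rsim sim => /= <-.
- have [ri simi] := sP i; have [rj simj] := sP j.
  apply: val_inj; rewrite -[val i](irr_reprK_pchar (@charF_pi' F gT L)).
  rewrite -[RHS](irr_reprK_pchar (@charF_pi' F gT L)); apply: irr_comp_rsim_pchar.
    exact: charF_pi'.
  apply: mx_rsim_trans simi (mx_rsim_trans _ (mx_rsim_sym simj)).
  exact/rsim_piso.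
case: Wp => /prep_reprP rW Wirr cop; have irrW := (prep_irrP rW).1 Wirr.
have sim := rsim_irr_comp_pchar (irrs F L) (@charF_pi' F gT L) irrW.
set i := irr_comp _ _ in sim.
have Ii : coprime (irr_degree i) p && (irr_mode i z == c).
  rewrite -(mxrank_rsim sim) /= cop /=.
  by have := mx_rsim_scalar Lz sim Wz; rewrite /irr_mode => ->; rewrite mxE eqxx.
exists (Sub i Ii); have [r simI] := sP (Sub i Ii).
apply/(rsim_piso r rW); apply: mx_rsim_trans (mx_rsim_sym simI) (mx_rsim_sym sim).
Qed.

End OrdinaryReps.

(** * Modules over the group algebra *)

Section GroupAlgebraModules.
Variables (F : fieldType) (G : finGroupType).
Local Notation A := (group_algebra F G).
Local Notation gab := (@ga_basis F G).
Local Notation one_cocycle := (fun _ _ : G => 1 : F).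

Lemma ga_sum (a : A) : a = \sum_g a g *: gab g.
Proof.
apply/ffunP=> g; rewrite sum_ffunE (bigD1 g) //= [X in _ + X]big1 ?addr0.
  by rewrite !ffunE eqxx /GRing.scale /= mulr1.
by move=> h hg; rewrite !ffunE eq_sym (negPf hg) scaler0.
Qed.

Section GaModule.
Variables (n : nat) (T : G -> 'M[F]_n.+1).
Hypothesis TM : forall g h, T g *m T h = T (g * h)%g.
Hypothesis T1 : T 1%g = 1%:M.

Definition ga_rep (a : A) : 'M[F]_n.+1 := \sum_g a g *: T g.

Lemma ga_rep_basis g : ga_rep (gab g) = T g.
Proof.
rewrite /ga_rep (bigD1 g) //= [X in _ + X]big1 ?addr0.
  by rewrite ffunE eqxx scale1r.
by move=> h hg; rewrite ffunE (negPf hg) scale0r.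
Qed.

Lemma ga_repZ c a : ga_rep (c *: a) = c *: ga_rep a.
Proof. by rewrite /ga_rep scaler_sumr; apply: eq_bigr => g _; rewrite ffunE -scalerA. Qed.

Fact ga_rep_linear : linear ga_rep.
Proof.
move=> c a b; rewrite /ga_rep scaler_sumr -big_split; apply: eq_bigr => g _ /=.
by rewrite !ffunE scalerDl scalerA.
Qed.

HB.instance Definition _ := GRing.isLinear.Build F A 'M[F]_n.+1 _ ga_rep ga_rep_linear.

Fact ga_rep_monoid : monoid_morphism ga_rep.
Proof.
split; first by rewrite -[1]/(gab 1%g) ga_rep_basis T1.
move=> a b; rewrite [in LHS](ga_sum a) [in LHS](ga_sum b).
rewrite mulr_suml raddf_sum [ga_rep a]/ga_rep mulr_suml; apply: eq_bigr => g _.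
rewrite mulr_sumr raddf_sum [ga_rep b]/ga_rep mulr_sumr; apply: eq_bigr => h _.
rewrite -scalerAl -scalerAr ga_basisM [LHS]ga_repZ ga_repZ ga_rep_basis -TM.
by rewrite -scalerAl -scalerAr.
Qed.

HB.instance Definition _ := GRing.isMonoidMorphism.Build A 'M[F]_n.+1 ga_rep ga_rep_monoid.

Definition ga_module : amodule A := existT _ n (ga_rep : {lrmorphism A -> 'M[F]_n.+1}).

End GaModule.

Definition ga_prep (M : amodule A) : prep F G :=
  existT _ (tag M) (fun g => mod_mx M (gab g)).

Lemma ga_prep_act (M : amodule A) (a : A) : mod_mx M a = \sum_g a g *: prep_mx (ga_prep M) g.
Proof.
by rewrite {1}(ga_sum a) mod_mx_sum; apply: eq_bigr => g _; rewrite mod_mxZ.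
Qed.

Lemma ga_prepP p (M : amodule A) : coprime_simple p M <-> pirr p [set: G] one_cocycle (ga_prep M).
Proof.
split=> [[/simple_modP simM cop]|[_ Wirr cop]].
  split=> //; first split=> [|g h _ _]; first by rewrite /prep_mx /= mod_mx1.
    by rewrite scale1r /prep_mx /= -mod_mxM ga_basisM.
  move=> v w v0; have [a <-] := simM v w v0; exists a.
  by rewrite ga_prep_act mulmx_suml; apply: eq_big => [g|//]; rewrite inE.
split=> //; apply/simple_modP => v w v0.
have [c <-] := Wirr v w v0; exists [ffun g => c g].
rewrite ga_prep_act mulmx_suml; apply: eq_big => [g|g _]; first by rewrite inE.
by rewrite ffunE.
Qed.

Lemma ga_prep_iso (M M' : amodule A) : mod_iso M M' <-> piso [set: G] (ga_prep M) (ga_prep M').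
Proof.
split=> [/mod_isoP|] [B [B' [BB' B'B BP]]].
  by exists B, B'; split=> // g _; apply: BP.
apply/mod_isoP; exists B, B'; split=> // a.
rewrite !ga_prep_act mulmx_sumr mulmx_suml; apply: eq_bigr => g _.
by rewrite -scalemxAr -scalemxAl BP ?inE.
Qed.

Lemma ga_transversal p (I : Type) (s : I -> prep F G) :
  transversal (pirr p [set: G] one_cocycle) (piso [set: G]) s ->
  exists t : I -> amodule A, transversal (coprime_simple p) (@mod_iso F A) t.
Proof.
apply: (@transversal_comap _ _ _ _ _ _ ga_prep).
- exact: piso_sym.
- exact: piso_trans.
- exact: (@pirr_piso _ _ _ [set: G]%G).
- exact: ga_prepP.
- exact: ga_prep_iso.
move=> W [[W1 WM] _ _].
have TM g h : prep_mx W g *m prep_mx W h = prep_mx W (g * h)%g.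
  by rewrite WM ?inE // scale1r.
exists (ga_module TM W1); exists 1%:M, 1%:M.
split=> [||g _]; rewrite ?mul1mx ?mulmx1 //.
rewrite /prep_mx /= /mod_mx /=; exact/esym/(ga_rep_basis (prep_mx W) g).
Qed.

End GroupAlgebraModules.

(** The group algebra is that of an abstract group [G], while the irreducible
representations counted are those of a subgroup [L] isomorphic to it.  This
allows normalizers to be treated inside the ambient group. *)
Lemma mu_group_algebra (F : numClosedFieldType) (G gT : finGroupType)
    (L : {group gT}) f g p :
  iso_on [set: G] L f g ->
  mu (group_algebra F G) p = #|[pred i : irrs F L | coprime (irr_degree i) p]|.
Proof.
move=> fg; have [s sP] := @irr_transversal F gT L p 1%g 1 (group1 _).
have s1 : transversal (pirr p L (fun _ _ => 1)) (piso L) s.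
  apply: eq_transversal sP => W; split=> [[]//|Wp]; split=> //.
  by case: Wp => -[].
have [t tP] := @transversal_pull F G gT p [set: G]%G L f g (fun _ _ => 1) (fun _ _ => 1)
  _ s fg (fun _ _ _ _ => erefl) s1.
have [u uP] := ga_transversal tP.
rewrite (mu_transversal uP) card_sig; apply: eq_card => i.
by rewrite !inE irr_mode1 eqxx andbT.
Qed.

(** * Central extensions by roots of unity *)

(** The cyclic kernel Z/(m+1) is taken to be ['I_m.+1], which is the trivial
group, as it should be, for [m = 0]. *)
Record addcocycle (K : finGroupType) (m : nat) := AddCocycle {
  addc :> K -> K -> 'I_m.+1;
  addcP : forall g h k, addc g h + addc (g * h)%g k = addc g (h * k)%g + addc h k;
  addc1g : forall g, addc 1%g g = 0;
  addcg1 : forall g, addc g 1%g = 0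
}.

Definition central_ext (K : finGroupType) (m : nat) (c : addcocycle K m) : Type :=
  (K * 'I_m.+1)%type.

Section CentralExtension.
Variables (K : finGroupType) (m : nat) (c : addcocycle K m).
Local Notation E := (central_ext c).
HB.instance Definition _ := Finite.on E.

Definition ext_mul (u v : E) : E := ((u.1 * v.1)%g, u.2 + v.2 + c u.1 v.1).
Definition ext_one : E := (1%g, 0).
Definition ext_inv (u : E) : E := (u.1^-1%g, - u.2 - c u.1^-1%g u.1).

Fact ext_mulA : associative ext_mul.
Proof.
move=> [g x] [h y] [k z]; congr (_, _); rewrite /= ?mulgA //.
rewrite -!addrA; congr (_ + (_ + _)).
by rewrite [RHS]addrCA addcP [c h k + _]addrC.
Qed.

Fact ext_mul1 : left_id ext_one ext_mul.
Proof. by move=> [g x]; rewrite /ext_mul /= mul1g add0r addc1g addr0. Qed.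

Fact ext_mulV : left_inverse ext_one ext_inv ext_mul.
Proof.
move=> [g x]; rewrite /ext_mul /= mulVg; congr (_, _).
by rewrite addrAC subrK addNr.
Qed.

HB.instance Definition _ := Finite_isGroup.Build E ext_mulA ext_mul1 ext_mulV.

Definition ext_proj (u : E) : K := u.1.
Lemma ext_projM : {in [set: E] &, {morph ext_proj : u v / (u * v)%g}}.
Proof. by []. Qed.
Canonical ext_proj_morphism := Morphism ext_projM.

Definition ext_pre (A : {set K}) : {set E} := [set u | ext_proj u \in A].

Fact ext_pre_group_set (A : {group K}) : group_set (ext_pre A).
Proof.
apply/group_setP; split=> [|u v]; first by rewrite inE group1.
by rewrite !inE; apply: groupM.
Qed.
Canonical ext_pre_group A := Group (ext_pre_group_set A).

Definition ext_lift (g : K) : E := (g, 0).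
Definition ext_cen (x : 'I_m.+1) : E := (1%g, x).
Definition ext_gen : E := ext_cen (inZp 1).

Lemma ext_lift1 : ext_lift 1%g = 1%g. Proof. by []. Qed.

Lemma ext_decomp (u : E) : u = (ext_cen u.2 * ext_lift u.1)%g.
Proof.
by case: u => g x; congr (_, _); rewrite /= ?mul1g // addr0 addc1g addr0.
Qed.

Lemma ext_genX k : (ext_gen ^+ k = ext_cen (inZp k))%g.
Proof.
elim: k => [|k IHk]; first by congr (_, _); apply: val_inj; rewrite /= mod0n.
rewrite expgS IHk; congr (_, _); rewrite /= ?mulg1 // addc1g addr0.
by apply: val_inj; rewrite /= modnDm.
Qed.

Lemma ext_gen_order : (ext_gen ^+ m.+1 = 1)%g.
Proof. by rewrite ext_genX; congr (_, _); apply: val_inj; rewrite /= modnn. Qed.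

Lemma ext_genE (x : 'I_m.+1) : (ext_gen ^+ x = ext_cen x)%g.
Proof. by rewrite ext_genX valZpK. Qed.

Lemma ext_cenC (x : 'I_m.+1) (u : E) : commute (ext_cen x) u.
Proof.
by congr (_, _); rewrite /= ?mul1g ?mulg1 // addc1g addcg1 !addr0 addrC.
Qed.

Lemma ext_cen_pre (A : {group K}) x : ext_cen x \in ext_pre A.
Proof. by rewrite inE group1. Qed.

Lemma ext_gen_center (A : {group K}) : ext_gen \in 'Z(ext_pre A)%g.
Proof.
apply/centerP; split=> [|u _]; first exact: ext_cen_pre.
exact: ext_cenC.
Qed.

Lemma card_ext_pre (A : {set K}) : #|ext_pre A| = (#|A| * m.+1)%N.
Proof.
rewrite -[in RHS](card_ord m.+1) -cardsT -cardsX; apply: eq_card => -[g x].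
by rewrite !inE /= andbT.
Qed.

Variable F : numClosedFieldType.
Variable zeta : F.
Hypothesis prim_zeta : m.+1.-primitive_root zeta.
Variable j : nat.

(** The j-th character of the kernel. *)
Definition zpow (x : 'I_m.+1) : F := zeta ^+ (j * x).

Lemma zpowD x y : zpow (x + y) = zpow x * zpow y.
Proof.
rewrite /zpow !(mulnC j) !exprM -exprMn -exprD; congr (_ ^+ _).
by rewrite /= (prim_expr_mod prim_zeta).
Qed.

Lemma zpow0 : zpow 0 = 1. Proof. by rewrite /zpow muln0. Qed.

Lemma zpow_gen : zpow (inZp 1) = zeta ^+ j.
Proof.
by rewrite /zpow mulnC exprM /= (prim_expr_mod prim_zeta) expr1.
Qed.

Lemma zpow_neq0 x : zpow x != 0.
Proof. by rewrite expf_neq0 // (prim_root_eq0 prim_zeta). Qed.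

(** The representation of the extension on which the kernel acts through its
j-th character and which is [W] on the chosen section of the projection. *)
Definition ext_prep (W : prep F K) : prep F E :=
  existT _ (tag W) (fun u : E => zpow u.2 *: prep_mx W u.1).

Lemma sum_ext_pre (V : nmodType) (A : {set K}) (f : E -> V) :
  \sum_(u in ext_pre A) f u = \sum_(g in A) \sum_(x : 'I_m.+1) f (g, x).
Proof.
rewrite pair_big /=; apply: eq_big => [[g x]|[g x] _] //.
by rewrite inE /= andbT.
Qed.

Definition ext_pirr p (A : {group K}) (V : prep F E) : Prop :=
  pirr p (ext_pre A) (fun _ _ => 1) V /\ prep_mx V ext_gen = (zeta ^+ j)%:M.

Lemma ext_prepP p (A : {group K}) W :
  pirr p A (fun g h => zpow (c g h)) W <-> ext_pirr p A (ext_prep W).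
Proof.
split=> [[[W1 WM] Wirr cop]|[[[W1 WM] Wirr cop] _]].
  split; last by rewrite /prep_mx /= W1 zpow_gen scalemx1.
  split=> //.
    split=> [|u v]; first by rewrite /prep_mx /= W1 zpow0 scale1r.
    rewrite !inE => Au Av; rewrite scale1r /prep_mx /= -scalemxAl -scalemxAr.
    by rewrite WM // !scalerA !zpowD.
  move=> v w v0; have [d <-] := Wirr v w v0.
  exists (fun u => if u.2 == 0 then d u.1 else 0).
  rewrite sum_ext_pre; apply: eq_bigr => g _; rewrite (bigD1 0) //= big1.
    by rewrite addr0 /prep_mx /= zpow0 scale1r.
  by move=> x /negPf x0; rewrite /= x0 scale0r mul0mx.
split=> //.
  split; first by have := W1; rewrite /prep_mx /= zpow0 scale1r.
  move=> g h Ag Ah; have := WM (ext_lift g) (ext_lift h).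
  rewrite !inE scale1r /prep_mx /= zpow0 !scale1r => -> //.
  by rewrite !add0r.
move=> v w v0; have [d <-] := Wirr v w v0.
exists (fun g => \sum_(x : 'I_m.+1) d (g, x) * zpow x).
rewrite sum_ext_pre; apply: eq_bigr => g _; rewrite scaler_suml mulmx_suml.
by apply: eq_bigr => x _; rewrite /prep_mx /= scalerA.
Qed.

Lemma ext_prep_iso (A : {group K}) W W' :
  piso A W W' <-> piso (ext_pre A) (ext_prep W) (ext_prep W').
Proof.
split=> -[B [B' [BB' B'B BP]]]; exists B, B'; split=> //.
  move=> u; rewrite inE => Au.
  by rewrite /prep_mx /= -scalemxAr -scalemxAl BP.
move=> g Ag; have := BP (ext_lift g); rewrite inE => /(_ Ag).
by rewrite /prep_mx /= zpow0 !scale1r.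
Qed.

Lemma ext_pirr_piso p (A : {group K}) V V' :
  ext_pirr p A V -> piso (ext_pre A) V V' -> ext_pirr p A V'.
Proof.
case=> VP Vz VV'; split; first exact: (@pirr_piso _ _ _ (ext_pre_group A)) VV'.
have [B [B' [BB' B'B BP]]] := VV'.
rewrite -[LHS]mulmx1 -BB' mulmxA -BP ?ext_cen_pre // Vz.
by rewrite mul_mx_scalar -scalemxAl BB' scalemx1.
Qed.

(** A representation of the extension over the j-th character is recovered
from its restriction to the section. *)
Lemma ext_prep_surj p (A : {group K}) V : ext_pirr p A V ->
  piso (ext_pre A) V (ext_prep (prep_pull ext_lift V)).
Proof.
case=> [[[V1 VM] _ _] Vz]; exists 1%:M, 1%:M.
split=> [||u Au]; rewrite ?mul1mx ?mulmx1 //.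
rewrite -[RHS]/(zpow u.2 *: prep_mx V (ext_lift u.1)).
have VX k : prep_mx V (ext_gen ^+ k)%g = ((zeta ^+ j) ^+ k)%:M.
  elim: k => [|k IHk]; first by rewrite V1.
  have := VM ext_gen (ext_gen ^+ k)%g; rewrite scale1r expgS => <-.
  - by rewrite Vz IHk -scalar_mxM -exprS.
  - exact: ext_cen_pre.
  by rewrite (@groupX _ (ext_pre_group A)) // ext_cen_pre.
have Vlift : ext_lift u.1 \in ext_pre A by move: Au; rewrite !inE.
have := VM (ext_cen u.2) (ext_lift u.1) (ext_cen_pre _ _) Vlift.
rewrite scale1r -ext_decomp -ext_genE VX mul_scalar_mx => <-.
by rewrite /zpow exprM.
Qed.

Lemma ext_transversal p (A : {group K}) :
  exists s : {i : irrs F (ext_pre_group A) |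
      coprime (irr_degree i) p && (irr_mode i ext_gen == zeta ^+ j)} -> prep F K,
    transversal (pirr p A (fun g h => zpow (c g h))) (piso A) s.
Proof.
have [s sP] := @irr_transversal F _ (ext_pre_group A) p ext_gen (zeta ^+ j)
  (ext_gen_center A).
apply: (transversal_comap (h := ext_prep)) sP.
- exact: piso_sym.
- exact: piso_trans.
- exact: ext_pirr_piso.
- exact: ext_prepP.
- exact: ext_prep_iso.
by move=> V VP; exists (prep_pull ext_lift V); apply: ext_prep_surj VP.
Qed.

End CentralExtension.

Section ExtSylow.
Variables (K : finGroupType) (m : nat) (c : addcocycle K m).
Local Notation E := (central_ext c).
Local Notation proj := (@ext_proj K m c).

(** Every Sylow p-subgroup of the preimage of [P] maps isomorphically onto [P],
because the kernel has order prime to p.  The preimage of [P] is the product of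
such a subgroup [Q] with the central kernel, so [Q] is the set of
p-elements of that preimage, and any element that normalizes the preimage of [P] normalizes
[Q]. *)
Lemma ext_sylow p (P : {group K}) : prime p -> coprime m.+1 p ->
    (p.-Sylow([set: K]) P)%g ->
  exists2 Q : {group E}, (p.-Sylow([set: E]) Q)%g
    & ('N(Q) = @ext_pre K m c 'N(P))%g.
Proof.
move=> p_pr com sylP; have pP := pHall_pgroup sylP.
have mp' : (m.+1`_p = 1)%N by rewrite part_p'nat // p'natE // -prime_coprime // coprime_sym.
have [Q sylQ] := Sylow_exists p (@ext_pre_group K m c P).
have sQP : Q \subset ext_pre c P := pHall_sub sylQ.
have cardQ : #|Q| = #|P|.
  rewrite (card_Hall sylQ) (card_ext_pre c) partnM ?cardG_gt0 // mp' muln1.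
  exact: part_pnat_id.
have cardE : #|[set: E]| = (#|[set: K]| * m.+1)%N.
  rewrite -(card_ext_pre c); apply: eq_card => u; by rewrite !inE.
have projQ : (proj @* Q = P)%g.
  apply/eqP; rewrite eqEcard; apply/andP; split.
    apply/subsetP=> g /morphimP[u _ Qu ->].
    by have := subsetP sQP u Qu; rewrite inE.
  rewrite card_morphim setTI -cardQ -{1}[#|Q|](LagrangeI Q ('ker proj)).
  rewrite coprime_TIg ?cards1 ?mul1n //.
  have -> : #|('ker proj)%g| = m.+1.
    rewrite -[RHS]mul1n -(cards1 (1%g : K)) -(card_ext_pre c).
    by apply: eq_card => u; rewrite !inE.
  have [k ->] := p_natP (pHall_pgroup sylQ).
  by rewrite coprimeXl // coprime_sym.
have sylQE : (p.-Sylow([set: E]) Q)%g.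
  rewrite pHallE subsetT /= cardE partnM ?cardG_gt0 // mp' muln1.
  by rewrite cardQ (card_Hall sylP).
exists Q => //; apply/setP=> u; rewrite [RHS]inE.
apply/idP/idP => nu.
  apply/normP; rewrite -projQ; apply/eqP.
  rewrite eqEcard cardJg leqnn andbT -morphimJ ?inE //.
  by rewrite (normP nu).
(* an element over P differs from an element of Q by a central one *)
have nQ : ext_pre c P \subset 'N(Q)%g.
  apply/subsetP=> v; rewrite inE -projQ => /morphimP[q _ Qq pv].
  have -> : v = (v * q^-1 * q)%g by rewrite mulgKV.
  rewrite groupM //; last by rewrite (subsetP (normG Q)).
  have -> : (v * q^-1)%g = ext_cen c (v * q^-1)%g.2.
    rewrite [LHS]ext_decomp.
    have -> : (v * q^-1)%g.1 = 1%g by rewrite -[LHS]/(ext_proj v * (ext_proj q)^-1)%g pv mulgV.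
    by rewrite ext_lift1 mulg1.
  by rewrite (subsetP (cent_sub Q)) //; apply/centP=> x _; apply: ext_cenC.
have nQP : (Q <| ext_pre c P)%g by rewrite /normal sQP.
apply/normP/eqP; rewrite eqEcard cardJg leqnn andbT.
apply/subsetP=> _ /imsetP[x Qx ->].
rewrite (mem_normal_Hall sylQ nQP); first by rewrite p_eltJ (mem_p_elt (pHall_pgroup sylQ)).
rewrite inE -[ext_proj _]/(ext_proj x ^ ext_proj u)%g memJ_norm //.
by have := subsetP sQP x Qx; rewrite inE.
Qed.

End ExtSylow.

(** * The McKay equality for cocycles of order prime to p *)

(** X^n - 1 is separable and splits in [F]. *)
Lemma prim_root_exists (F : numClosedFieldType) n : (0 < n)%N ->
  exists z : F, n.-primitive_root z.
Proof.
move=> n0; set q : {poly F} := 'X^n - 1.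
have [r] := closed_field_poly_normal q.
rewrite [lead_coef q](monicP (monicXnsubC 1 n0)) scale1r => qE.
have n_roots : (n <= size r)%N.
  by have := size_prod_XsubC r id; rewrite -qE size_XnsubC // => -[->].
have r_uniq : uniq r.
  by rewrite -separable_prod_XsubC -qE separable_Xn_sub_1 // pnatr_eq0 -lt0n.
have r_unity : all n.-unity_root r.
  by apply/allP=> z zr; rewrite /root_of_unity -/q qE root_prod_XsubC.
by have /hasP[z _] := has_prim_root n0 r_unity r_uniq n_roots; exists z.
Qed.

Section RootsOfUnityMcKay.
Variables (F : numClosedFieldType) (p : nat).
Hypothesis p_prime : prime p.
Hypothesis MC1 : forall (H : finGroupType) (Q : {group H}),
  (p.-Sylow([set: H]) Q)%g ->
  M_pair p (group_algebra F H) (group_algebra F (subg_of 'N(Q)%G)).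

Definition norm_cocycle (K : finGroupType) (b : K -> K -> F) : Prop :=
  [/\ forall g h, b g h != 0,
      forall g h k, b g h * b (g * h)%g k = b g (h * k)%g * b h k,
      forall g, b 1%g g = 1 & forall g, b g 1%g = 1].

Definition mckay_for (K : finGroupType) (P : {group K}) (b : K -> K -> F) : Prop :=
  exists n, exists s : 'I_n -> prep F K, exists s' : 'I_n -> prep F K,
    transversal (pirr p [set: K] b) (piso [set: K]) s
    /\ transversal (pirr p 'N(P)%g b) (piso 'N(P)%g) s'.

Variables (K : finGroupType) (P : {group K}).
Hypothesis sylP : (p.-Sylow([set: K]) P)%g.

Lemma addcocycle_log m (zeta : F) (b : K -> K -> F) :
    m.+1.-primitive_root zeta -> norm_cocycle b ->
    (forall g h, b g h ^+ m.+1 = 1) ->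
  exists c : addcocycle K m, forall g h, b g h = zeta ^+ c g h.
Proof.
move=> prim_z [b0 bP b1g bg1] bm.
pose c g h := sval (prim_rootP prim_z (bm g h)).
have cE g h : b g h = zeta ^+ c g h := svalP (prim_rootP prim_z (bm g h)).
have zinj (x y : 'I_m.+1) : zeta ^+ x = zeta ^+ y -> x = y.
  move/eqP; rewrite (eq_prim_root_expr prim_z) !modn_small // => /eqP.
  exact: val_inj.
have zD (x y : 'I_m.+1) : zeta ^+ (x + y)%R = zeta ^+ x * zeta ^+ y.
  by rewrite /= (prim_expr_mod prim_z) exprD.
have cP g h k : c g h + c (g * h)%g k = c g (h * k)%g + c h k.
  by apply: zinj; rewrite !zD -!cE.
have c1 g : c 1%g g = 0 by apply: zinj; rewrite -cE b1g.
have c1' g : c g 1%g = 0 by apply: zinj; rewrite -cE bg1.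
by exists (AddCocycle cP c1 c1').
Qed.

(** The counts for [K] and for the normalizer, summed over all characters of
the kernel of the central extension, are equal by [MC1].  A character that is
not faithful has a smaller order, and the induction applies to it; the faithful
ones all contribute the same amount. *)
Lemma mckay_roots_of_unity m (b : K -> K -> F) :
    (0 < m)%N -> coprime m p -> norm_cocycle b -> (forall g h, b g h ^+ m = 1) ->
  mckay_for P b.
Proof.
elim/ltn_ind: m b => -[//|m] IHm b _ com bcoc bm.
have [zeta prim_z] := prim_root_exists F (ltn0Sn m).
have [c cE] := addcocycle_log prim_z bcoc bm.
have [Q sylQ NQ] := ext_sylow c p_prime com sylP.
pose L (A : {group K}) := ext_pre_group c A.
pose cnt (A : {group K}) j := mode_count (L A) p (ext_gen c) (zeta ^+ j).
have trans A j := ext_transversal c prim_z j p A.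
have total : (\sum_(j < m.+1) cnt [set: K]%G j = \sum_(j < m.+1) cnt 'N(P)%G j)%N.
  rewrite !(sum_mode_count p (ext_gen_center c _) (ext_gen_order c) prim_z).
  have := MC1 sylQ; rewrite /M_pair.
  rewrite (@mu_group_algebra F _ _ (L [set: K]%G) id id); last first.
    by split=> // x _; rewrite inE inE.
  rewrite (@mu_group_algebra F _ _ (L 'N(P)%G) (@sgval _ 'N(Q)%G) (subg 'N(Q)%G)) //.
  split=> //.
  - by move=> u _; rewrite -[L _ : {set _}]NQ; apply: subgP.
  - by move=> u _; apply: sgvalK.
  by move=> u; rewrite -[L _ : {set _}]NQ => uN; apply: subgK.
(* b^j has values in the roots of unity of order m+1 divided by gcd(j, m+1) *)
have noncop (j : 'I_m.+1) : ~~ coprime j m.+1 -> cnt [set: K]%G j = cnt 'N(P)%G j.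
  move=> ncop; pose d := gcdn j m.+1.
  have d0 : (0 < d)%N by rewrite gcdn_gt0 orbT.
  have d1 : (1 < d)%N by rewrite ltn_neqAle eq_sym ncop.
  have dm : (d %| m.+1)%N := dvdn_gcdr _ _.
  have bcocj : norm_cocycle (fun g h => zpow zeta j (c g h)).
    split=> [g h|g h k|g|g].
    - exact: zpow_neq0.
    - by rewrite -!(zpowD prim_z) addcP.
    - by rewrite addc1g zpow0.
    - by rewrite addcg1 zpow0.
  have [] := IHm (m.+1 %/ d)%N _ _ _ _ bcocj.
  - by rewrite ltn_Pdiv.
  - by rewrite divn_gt0 // dvdn_leq.
  - by apply: coprime_dvdl com; apply: dvdn_div.
  - move=> g h; rewrite /zpow -exprM; apply/eqP; rewrite -(prim_order_dvd prim_z).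
    rewrite mulnAC muln_divA // [(j * _)%N]mulnC -muln_divA ?dvdn_gcdl //.
    by rewrite -mulnA dvdn_mulr.
  move=> n [s [s' [sT sN]]].
  have [t tT] := trans [set: K]%G j; have [t' tN] := trans 'N(P)%G j.
  have eT := transversal_card (@piso_sym _ _ _) (@piso_trans _ _ _) sT tT.
  have eN := transversal_card (@piso_sym _ _ _) (@piso_trans _ _ _) sN tN.
  by rewrite card_sig in eT; rewrite card_sig in eN; apply: etrans (esym eT) eN.
have cop A (j : 'I_m.+1) : coprime j m.+1 -> cnt A j = cnt A 1%N.
  move=> cj; rewrite /cnt expr1.
  exact: (mode_count_conj p (ext_gen_center c A) (ext_gen_order c) prim_z cj).
have cnt1 : cnt [set: K]%G 1%N = cnt 'N(P)%G 1%N.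
  move: total; rewrite (bigID (fun j : 'I_m.+1 => coprime j m.+1)) /=.
  rewrite [in RHS](bigID (fun j : 'I_m.+1 => coprime j m.+1)) /=.
  rewrite [X in (_ + X)%N = _](eq_bigr _ noncop) => /addIn.
  rewrite (eq_bigr _ (cop _)) [RHS](eq_bigr _ (cop _)) !sum_nat_const => /eqP.
  rewrite eqn_pmul2l => [/eqP//|].
  (* for m = 0 the residue of 1 is 0, which is prime to m+1 = 1 *)
  apply/card_gt0P; exists (inord (1 %% m.+1)).
  suff: coprime (inord (1 %% m.+1) : 'I_m.+1) m.+1 by [].
  rewrite inordK ?ltn_mod //.
  by rewrite coprime_modl coprime1n.
have bE : b = (fun g h => zpow zeta 1 (c g h)).
  by apply/funext=> g; apply/funext=> h; rewrite cE /zpow mul1n.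
have [s sT] := trans [set: K]%G 1%N; have [s' sN] := trans 'N(P)%G 1%N.
rewrite -!bE in sT sN.
exists (cnt [set: K]%G 1%N).
have [t tT] : exists t : 'I_(cnt [set: K]%G 1%N) -> prep F K,
    transversal (pirr p [set: K] b) (piso [set: K]) t.
  by apply: transversal_ord sT; rewrite card_sig.
have [t' tN] : exists t : 'I_(cnt [set: K]%G 1%N) -> prep F K,
    transversal (pirr p 'N(P)%g b) (piso 'N(P)%g) t.
  by apply: transversal_ord sN; rewrite cnt1 card_sig.
by exists t, t'.
Qed.

End RootsOfUnityMcKay.

(** * The McKay equality for arbitrary cocycles *)

Section ProjectiveMcKay.
Variables (F : numClosedFieldType) (p : nat).
Hypothesis p_prime : prime p.
Hypothesis MC1 : forall (H : finGroupType) (Q : {group H}),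
  (p.-Sylow([set: H]) Q)%g ->
  M_pair p (group_algebra F H) (group_algebra F (subg_of 'N(Q)%G)).

Section CosetSpace.
Variables (K : finGroupType) (b : K -> K -> F).
Hypothesis bcoc : norm_cocycle b.

(** Translation on all subsets of [K]; the orbit of a subgroup is its set of
cosets, and its stabilizer is the subgroup itself. *)
Definition coset_act (g : K) (A : {set K}) : {set K} := (g *: A)%g.

Fact coset_act1 A : coset_act 1%g A = A. Proof. exact: lcoset1. Qed.

Fact coset_actM g h A : coset_act (g * h)%g A = coset_act g (coset_act h A).
Proof. exact: lcosetM. Qed.

Fact coset_space_nonempty : (0 < #|{set K}|)%N.
Proof. by apply/card_gt0P; exists set0. Qed.

Definition coset_gset : gset K := Gset coset_act1 coset_actM coset_space_nonempty.

Definition const_cocycle_val (g h : K) : {ffun coset_gset -> F} := [ffun _ => b g h].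

Fact const_cocycle_unit g h x : const_cocycle_val g h x != 0.
Proof. by case: bcoc => b0 _ _ _; rewrite ffunE. Qed.

Fact const_cocycleP g h k x :
  const_cocycle_val g h x * const_cocycle_val (g * h)%g k x
  = const_cocycle_val g (h * k)%g x * const_cocycle_val h k (gact g^-1%g x).
Proof. by case: bcoc => _ bP _ _; rewrite !ffunE. Qed.

Fact const_cocycle1g g x : const_cocycle_val 1%g g x = 1.
Proof. by case: bcoc => _ _ b1 _; rewrite ffunE. Qed.

Fact const_cocycleg1 g x : const_cocycle_val g 1%g x = 1.
Proof. by case: bcoc => _ _ _ b1; rewrite ffunE. Qed.

(** A scalar cocycle viewed in the functions on the coset space.  The twisted
double it defines contains the twisted group algebra of [K], through the sum
of e(x) (x) g over all [x], and its modules induced from the point [P]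
restrict to representations induced from [P] to [K]. *)
Definition const_cocycle : cocycle F coset_gset :=
  Cocycle const_cocycle_unit const_cocycleP const_cocycle1g const_cocycleg1.

Lemma stab_coset (P : {group K}) : stab (X := coset_gset) (P : {set K}) = P.
Proof.
apply/setP=> g; apply/stabP/idP => [<-|Pg]; last exact: lcoset_id.
exact: lcoset_refl.
Qed.

(** The degree is multiplied by the index of a Sylow p-subgroup. *)
Lemma induced_prep (P : {group K}) (V : prep F K) :
  (p.-Sylow([set: K]) P)%g -> is_prep P b V -> coprime (tag V).+1 p ->
  exists2 W : prep F K, is_prep [set: K] b W & coprime (tag W).+1 p.
Proof.
move=> sylP [V1 VM] copV.
have Vrep : is_prep (stab (X := coset_gset) (P : {set K}))
    (stab_cocycle const_cocycle (P : {set K})) V.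
  split=> // g h; rewrite stab_coset => Pg Ph.
  by rewrite VM // /stab_cocycle ffunE.
have [M [_ _ dimM _]] := ind_exists Vrep.
pose W : prep F K :=
  existT _ (tag M) (fun g => mod_mx M (\sum_x td_basis const_cocycle x g)).
exists W.
  split=> [|g h _ _]; first by rewrite -[RHS](mod_mx1 M).
  rewrite /prep_mx /= -mod_mxM -mod_mxZ; congr mod_mx.
  rewrite mulr_suml scaler_sumr; apply: eq_bigr => x _.
  rewrite mulr_sumr (bigD1 (@gact K coset_gset g^-1%g x)) //= big1 => [|y yx].
    by rewrite addr0 td_basisM gactKV eqxx mulr1 ffunE.
  rewrite td_basisM; case: eqP => [xE|_]; last by rewrite mulr0 scale0r.
  by case/eqP: yx; rewrite xE; apply/esym/(@gactK K coset_gset).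
rewrite /= -[(tag M).+1]/(mod_dim M) dimM coprimeMl copV andbT.
apply: (coprime_orb_fixed p_prime sylP) => g Pg.
exact: lcoset_id.
Qed.

End CosetSpace.

(** The determinant of a projective representation of degree m exhibits b^m as
a coboundary, and dividing by m-th roots of the determinants turns b into a
cocycle with values in the m-th roots of unity. *)
Theorem projective_mckay (K : finGroupType) (P : {group K}) (b : K -> K -> F) :
  (p.-Sylow([set: K]) P)%g -> norm_cocycle b -> mckay_for p P b.
Proof.
move=> sylP bcoc.
have [[V Vrep copV]|noV] := pselect (exists2 V : prep F K, is_prep P b V & coprime (tag V).+1 p);
  last first.
  have empty (A : {group K}) : P \subset A ->
      exists s : 'I_0 -> prep F K, transversal (pirr p A b) (piso A) s.
    move=> sPA; have s0 (i : 'I_0) : prep F K by case: i.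
    exists s0; split=> [[]//|[]//|W [[W1 WM] _ copW]]; case: noV; exists W => //.
    by split=> // g h /(subsetP sPA) Ag /(subsetP sPA) Ah; apply: WM.
  have [s sT] := empty [set: K]%G (subsetT _).
  have [s' sN] := empty 'N(P)%G (normG P).
  by exists 0%N, s, s'.
have [W [W1 WM] copW] := induced_prep bcoc sylP Vrep copV.
have [b0 bP b1g bg1] := bcoc.
set m := (tag W).+1 in copW.
have detM g h : \det (prep_mx W g) * \det (prep_mx W h)
    = b g h ^+ m * \det (prep_mx W (g * h)%g).
  by rewrite -det_mulmx WM ?inE // detZ.
have det0 g : \det (prep_mx W g) != 0.
  have := detM g g^-1%g; rewrite mulgV W1 det1 mulr1 => /eqP.
  by apply: contraTneq => ->; rewrite mul0r eq_sym expf_neq0.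
(* the value 1 at the identity keeps the new cocycle normalized *)
pose c g := if g == 1%g then 1 else m.-root (\det (prep_mx W g)).
have cm g : c g ^+ m = \det (prep_mx W g).
  rewrite /c; case: eqP => [->|_]; first by rewrite W1 det1 expr1n.
  by rewrite rootCK.
have c0 g : c g != 0.
  by apply: contraNneq (det0 g) => cg; rewrite -cm cg expr0n.
have c1 : c 1%g = 1 by rewrite /c eqxx.
pose b' g h := b g h * c (g * h)%g / (c g * c h).
have [n [s [s' [sT sN]]]] : mckay_for p P b'.
  apply: (mckay_roots_of_unity p_prime MC1 sylP (m := m)) => //.
    split=> [g h|g h k|g|g].
    - by rewrite !mulf_neq0 ?invr_eq0 ?mulf_neq0.
    - have bE : b g h = b g (h * k)%g * b h k / b (g * h)%g k by rewrite -bP mulfK.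
      rewrite /b' bE mulgA; field.
      by rewrite !c0 b0.
    - by rewrite /b' b1g c1 mul1g !mul1r mulfV.
    - by rewrite /b' bg1 c1 mulg1 mulr1 mul1r mulfV.
  move=> g h; rewrite /b' expr_div_n !exprMn !cm detM mulfV //.
  by rewrite mulf_neq0 ?expf_neq0.
have bb' x y : b x y * c (x * y)%g = c x * c y * b' x y.
  by rewrite /b' [RHS]mulrC divfK // mulf_neq0.
have [t tT] := transversal_scale (A := [set: K]%G) c0 c1 bb' sT.
have [t' tN] := transversal_scale (A := 'N(P)%G) c0 c1 bb' sN.
by exists n, t, t'.
Qed.

End ProjectiveMcKay.

(** * Reduction of the twisted double to stabilizers *)

Section Reduction.
Variables (F : numClosedFieldType) (p : nat).
Hypothesis p_prime : prime p.
Hypothesis MC1 : forall (H : finGroupType) (Q : {group H}),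
  (p.-Sylow([set: H]) Q)%g ->
  M_pair p (group_algebra F H) (group_algebra F (subg_of 'N(Q)%G)).
Variables (G : finGroupType) (X : gset G) (alpha : cocycle F X).
Variable P : {group G}.
Hypothesis sylP : (p.-Sylow([set: G]) P)%g.

Local Notation N := 'N(P)%G.
Local Notation XN := (res_gset X N).
Local Notation fixedP y := (forall g, g \in P -> gact g y = y).

Lemma stab_sylow (y : X) : fixedP y ->
  (p.-Sylow([set: subg_of (stab_group y)]) (subg (stab_group y) @* P))%g.
Proof.
move=> fixy; have sPS : P \subset stab y.
  by apply/subsetP=> g /fixy gy; apply/stabP.
have sylS : (p.-Sylow(stab y) P)%g := pHall_subl sPS (subsetT _) sylP.
have := morphim_pHall (subg_morphism (stab_group y)) sPS sylS.
by rewrite im_subg.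
Qed.

Lemma sub_sylow_norm : (p.-Sylow([set: subg_of N]) (subg N @* P))%g.
Proof.
have sylN : (p.-Sylow(N) P)%g := pHall_subl (normG P) (subsetT _) sylP.
have := morphim_pHall (subg_morphism N) (normG P) sylN.
by rewrite im_subg.
Qed.

Lemma mem_sub_im (A B : {group G}) (u : subg_of B) : A \subset B ->
  (u \in (subg B @* A)%g) = (sgval u \in A).
Proof.
move=> sAB; apply/morphimP/idP => [[g Bg Ag ->]|Au].
  by rewrite subgK.
by exists (sgval u); rewrite ?subgP //= sgvalK.
Qed.

(** Normalizers of the image of [A] are computed inside the subgroup [B]. *)
Lemma norm_sub_im (A B : {group G}) (u : subg_of B) : A \subset B ->
  (u \in 'N(subg B @* A)%g) = (sgval u \in 'N(A)%g).
Proof.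
move=> sAB; apply/normP/normP => [nu|nu].
  apply/eqP; rewrite eqEcard cardJg leqnn andbT.
  apply/subsetP=> _ /imsetP[g Ag ->].
  have Bg := subsetP sAB g Ag.
  have : (subg B g ^ u)%g \in (subg B @* A)%g.
    by rewrite -nu memJ_conjg mem_sub_im // subgK.
  by rewrite mem_sub_im // -[sgval _]/(sgval (subg B g) ^ sgval u)%g subgK.
apply/eqP; rewrite eqEcard cardJg leqnn andbT.
apply/subsetP=> _ /imsetP[v Av ->]; rewrite mem_sub_im // in Av.
by rewrite mem_sub_im // -[sgval _]/(sgval v ^ sgval u)%g -nu memJ_conjg.
Qed.

(** [projective_mckay] for the stabilizer of [y], with the normalizer of [P] in
that stabilizer read as the stabilizer of [y] in the normalizer of [P]. *)
Lemma stab_counts (y : X) : fixedP y ->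
  exists n, exists s : 'I_n -> prep F G, exists s' : 'I_n -> prep F (subg_of N),
    transversal (pirr p (stab y) (stab_cocycle alpha y)) (piso (stab y)) s
    /\ transversal (pirr p (stab (X := XN) y) (stab_cocycle (res_cocycle N alpha) (y : XN)))
         (piso (stab (X := XN) y)) s'.
Proof.
move=> fixy; pose S := stab_group y.
have sPS : P \subset S by apply/subsetP=> g /fixy gy; apply/stabP.
pose b (u v : subg_of S) := alpha (sgval u) (sgval v) y.
have bcoc : norm_cocycle b.
  split=> [u v|u v w|u|u]; rewrite /b.
  - exact: cocycle_unit.
  - have := cocycleP alpha (sgval u) (sgval v) (sgval w) y.
    have -> // : gact (sgval u)^-1%g y = y.
    by apply/stabP; rewrite groupV subgP.
  - exact: cocycle1g.
  - exact: cocycleg1.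
have [n [s [s' [sT sN]]]] := projective_mckay p_prime MC1 (stab_sylow fixy) bcoc.
exists n.
have [t tT] : exists t : 'I_n -> prep F G,
    transversal (pirr p S (stab_cocycle alpha y)) (piso S) t.
  apply: (@transversal_pull F _ _ p S [set: subg_of S]%G (subg S) (@sgval _ S)) sT.
    split=> [g _|u _|g Sg|u _|g h Sg Sh].
    - exact: in_setT.
    - exact: subgP.
    - exact: subgK.
    - exact: sgvalK.
    - exact: subgM.
  by move=> g h Sg Sh; rewrite /b !subgK.
have [t' tN] : exists t : 'I_n -> prep F (subg_of N),
    transversal (pirr p (stab (X := XN) y) (stab_cocycle (res_cocycle N alpha) (y : XN)))
         (piso (stab (X := XN) y)) t.
  apply: (@transversal_pull F _ _ p (@stab_group _ XN y)
    'N(subg S @* P)%G (fun u => subg S (sgval u)) (fun v => subg N (sgval v))) sN.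
    have inS (u : subg_of N) : u \in stab (X := XN) y -> sgval u \in S.
      by rewrite !inE.
    have inN (v : subg_of S) : v \in 'N(subg S @* P)%g -> sgval v \in N.
      by rewrite norm_sub_im.
    split=> [u /inS uS|v /inN vN|u /inS uS|v /inN vN|u v /inS uS /inS vS].
    - by rewrite norm_sub_im // subgK // subgP.
    - by have := subgP v; rewrite !inE /= /res_gact subgK.
    - by rewrite subgK // sgvalK.
    - by rewrite subgK // sgvalK.
    - by rewrite -subgM.
  by move=> u v; rewrite !inE => Su Sv; rewrite /b !subgK ?inE.
by exists t, t'.
Qed.

Let orbN (x : X) : {set X} := orb (X := XN) x.

(** [pick] depends only on the set that it chooses from, so points of one orbit
of the normalizer have the same representative. *)
Definition orbit_rep (x : X) : X := odflt x [pick y in orbN x].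

Lemma orbN_P (x y : X) : reflect (exists2 g, g \in N & gact g x = y) (y \in orbN x).
Proof.
apply: (iffP (@orbP _ XN x y)) => [[u <-]|[g Ng <-]].
  by exists (sgval u); rewrite ?subgP.
by exists (subg N g); rewrite /= /res_gact subgK.
Qed.

Lemma orbit_rep_in x : orbit_rep x \in orbN x.
Proof.
rewrite /orbit_rep; case: pickP => [//|/(_ x)].
by rewrite (@orb_refl _ XN).
Qed.

Lemma orbit_rep_eq x y : y \in orbN x -> orbit_rep y = orbit_rep x.
Proof.
move=> yx; have eqo : orbN y = orbN x.
  apply/setP=> z; apply/idP/idP; first exact: (@orb_trans _ XN).
  exact/(@orb_trans _ XN)/(@orb_sym _ XN).
rewrite /orbit_rep eqo; case: pickP => [//|/(_ x)].
by rewrite (@orb_refl _ XN).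
Qed.

Lemma orbit_rep_fixed x : fixedP x -> fixedP (orbit_rep x).
Proof.
move=> fixx g Pg; have /orbN_P[n Nn <-] := orbit_rep_in x.
rewrite -gactM -[(g * n)%g](mulKVg n) (gactM n) fixx //.
by rewrite -conjgE memJ_norm.
Qed.

Definition orbit_reps : {set X} :=
  [set y | [forall (g | g \in P), gact g y == y] && (orbit_rep y == y)].

Lemma orbit_repsP y : reflect (fixedP y /\ orbit_rep y = y) (y \in orbit_reps).
Proof.
rewrite inE; apply: (iffP andP) => [[fixy /eqP ry]|[fixy ->]]; split=> //.
  by move=> g Pg; apply/eqP; apply: (forall_inP fixy).
by apply/forall_inP=> g Pg; apply/eqP/fixy.
Qed.

(** If [g] moves [x] to [y], then [P] and its conjugate by [g] are Sylow
subgroups of the stabilizer of [x]; an element of that stabilizer conjugating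
one to the other corrects [g] to an element of the normalizer of [P]. *)
Lemma fixed_fusion x y : fixedP x -> fixedP y -> y \in orb x -> y \in orbN x.
Proof.
move=> fixx fixy /orbP[g gx].
have sPS : P \subset stab x by apply/subsetP=> h /fixx hx; apply/stabP.
have sylS : (p.-Sylow(stab_group x) P)%g := pHall_subl sPS (subsetT _) sylP.
have sPgS : (P :^ g)%g \subset stab x.
  apply/subsetP=> _ /imsetP[h Ph ->]; apply/stabP.
  by rewrite conjgE !gactM gx fixy // -gx gactK.
have sylSg : (p.-Sylow(stab_group x) (P :^ g)%G)%g.
  by apply: pHall_subl sPgS (subsetT _) _; rewrite pHallJ ?inE.
have [h /stabP hx Pgh] := Sylow_trans sylS sylSg.
apply/orbN_P; exists (g * h^-1)%g.
  by apply/normP; rewrite conjsgM Pgh -conjsgM mulgV conjsg1.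
by rewrite gactM -{1}hx gactK.
Qed.

(** The representatives of the orbits of the normalizer on the fixed points of
[P] represent the orbits of length prime to p of both groups, and
[stab_counts] gives the same number of induced modules at each of them. *)
Theorem M_pair_twisted_double :
  M_pair p (twisted_double alpha) (twisted_double (res_cocycle N alpha)).
Proof.
have cnt (y : X) : exists n, exists s : 'I_n -> prep F G,
    exists s' : 'I_n -> prep F (subg_of N), y \in orbit_reps ->
    transversal (pirr p (stab y) (stab_cocycle alpha y)) (piso (stab y)) s
    /\ transversal (pirr p (stab (X := XN) y) (stab_cocycle (res_cocycle N alpha) (y : XN)))
         (piso (stab (X := XN) y)) s'.
  have [/orbit_repsP[fixy _]|_] := boolP (y \in orbit_reps).
    by have [n [s [s' h]]] := stab_counts fixy; exists n, s, s'.
  have f (i : 'I_0) : False by case: i.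
  by exists 0%N, (fun i => match f i with end), (fun i => match f i with end).
pose n y := sval (cid (cnt y)).
pose s y := sval (cid (svalP (cid (cnt y)))).
pose s' y := sval (cid (svalP (cid (svalP (cid (cnt y)))))).
have sP y : y \in orbit_reps -> _ := svalP (cid (svalP (cid (svalP (cid (cnt y)))))).
have [t tP] : exists t : {y : {y : X | y \in orbit_reps} & 'I_(n (val y))} ->
    amodule (twisted_double alpha), transversal (coprime_simple p) (@mod_iso _ _) t.
  apply: (td_transversal (s := s)) => [x copx|y y' Yy Yy' yy'|y Yy|y Yy].
  - have [z zx fixz] := fixed_point_of_orb p_prime sylP copx.
    exists (orbit_rep z).
      apply/orbit_repsP; split; first exact: orbit_rep_fixed.
      exact/orbit_rep_eq/orbit_rep_in.
    apply: orb_trans zx _; have /orbN_P[g _ <-] := orbit_rep_in z.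
    by apply/orbP; exists g.
  - have /orbit_repsP[fixy <-] := Yy; have /orbit_repsP[fixy' <-] := Yy'.
    exact/esym/orbit_rep_eq/fixed_fusion.
  - have /orbit_repsP[fixy _] := Yy. apply: (@coprime_orb_fixed G X p p_prime P sylP y fixy).
  - by have [] := sP y Yy.
have [t' t'P] : exists t : {y : {y : X | y \in orbit_reps} & 'I_(n (val y))} ->
    amodule (twisted_double (res_cocycle N alpha)),
    transversal (coprime_simple p) (@mod_iso _ _) t.
  apply: (@td_transversal F _ XN _ p orbit_reps n s') => [x copx|y y' Yy Yy' yy'|y Yy|y Yy].
  - have [z zx fixz] := fixed_point_of_orb p_prime sub_sylow_norm copx.
    have fixz' : fixedP (z : X).
      move=> g Pg; have Ng : g \in N := subsetP (normG P) g Pg.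
      have := fixz (subg N g); rewrite mem_sub_im ?normG // /= /res_gact subgK //.
      exact.
    exists (orbit_rep z).
      apply/orbit_repsP; split; first exact: orbit_rep_fixed.
      exact/orbit_rep_eq/orbit_rep_in.
    exact: (@orb_trans _ XN) zx (orbit_rep_in z).
  - have /orbit_repsP[fixy <-] := Yy; have /orbit_repsP[fixy' <-] := Yy'.
    exact/esym/orbit_rep_eq.
  - have /orbit_repsP[fixy _] := Yy.
    apply: (@coprime_orb_fixed _ XN p p_prime _ sub_sylow_norm) => u.
    by rewrite mem_sub_im ?normG // => /fixy.
  - by have [] := sP y Yy.
by rewrite /M_pair (mu_transversal tP) (mu_transversal t'P).
Qed.

End Reduction.

Theorem theorem3p3 (R : realType) (p : nat) (p_prime : prime p)
    (MC1 : forall (H : finGroupType) (Q : {group H}),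
       (p.-Sylow([set: H]) Q)%g ->
       M_pair p (group_algebra R[i]%C H)
                (group_algebra R[i]%C (subg_of 'N(Q)%G)))
    (G : finGroupType) (X : gset G) (alpha : cocycle R[i]%C X)
    (P : {group G}) (sylP : (p.-Sylow([set: G]) P)%g) :
  M_pair p (twisted_double alpha)
           (twisted_double (res_cocycle 'N(P)%G alpha)).
Proof. exact: M_pair_twisted_double. Qed.
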